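(* There exists a (randomized) algorithm for the graphic matroid secretary problem that is $3.95$-competitive on the family of all finite loopless multigraphs with nonnegative edge weights. That is, for every such weighted multigraph $G$, the algorithm outputs an acyclic set of edges $A$ with $3.95\cdot\mathbb{E}[w(A)]\ge OPT(G)$.
   Context: Graphic matroid secretary problem: the input is a finite undirected multigraph $G=(V,E)$ without loops (parallel edges allowed), with $|V|=n$, $|E|=m$ and edge weights $w:E\to\mathbb{R}_{\ge 0}$. The algorithm knows $V$ and $m$ in advance. The edges of $E$ arrive one at a time in an order chosen uniformly at random among all orderings of $E$; when an edge arrives the algorithm learns its endpoints and its weight and must immediately and irrevocably accept or reject it, subject to the constraint that the set of accepted edges is always acyclic (a forest; in a multigraph two parallel edges form a cycle). The algorithm may use internal randomness. $ALG$ denotes the total weight of accepted edges and $OPT(G)$ the maximum weight of an acyclic edge set of $G$. An algorithm is $\alpha$-competitive ($\alpha\ge 1$) on a family of weighted graphs if $\alpha\cdot\mathbb{E}[ALG]\ge OPT(G)$ for every graph in the family, the expectation being over the random arrival order and the algorithm's randomness. *)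

(* Defs.v *)
From Stdlib Require Import Reals.
From HB Require Import structures.
From mathcomp Require Import all_boot all_order all_algebra all_fingroup.
From mathcomp Require Import boolp Rstruct.
Set Implicit Arguments. Unset Strict Implicit. Unset Printing Implicit Defensive.
Import Order.TTheory GRing.Theory Num.Theory.
Local Open Scope ring_scope.

(* A loopless multigraph on vertex set 'I_n with m edges 'I_m is given by
   ends : 'I_m -> 'I_n * 'I_n with (ends e).1 != (ends e).2.
   Parallel edges (distinct e, e' with the same endpoints) are allowed. *)

Definition loopless (n m : nat) (ends : 'I_m -> 'I_n * 'I_n) : Prop :=
  forall e : 'I_m, (ends e).1 != (ends e).2.

Definition joins (n m : nat) (ends : 'I_m -> 'I_n * 'I_n) (e : 'I_m) (a b : 'I_n) : bool :=
  (ends e == (a, b)) || (ends e == (b, a)).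

(* es = [e_0;...;e_(k-1)], vs = [v_0;...;v_(k-1)] form a cycle of length k >= 2
   using edges of F: distinct edges, distinct vertices, and e_i joins v_i and
   v_(i+1 mod k) (rot 1 vs = [v_1;...;v_(k-1);v_0]).
   (k = 2 covers two parallel edges.) *)
Definition is_cycle_in (n m : nat) (ends : 'I_m -> 'I_n * 'I_n) (F : {set 'I_m})
    (es : seq 'I_m) (vs : seq 'I_n) : bool :=
  [&& size es == size vs, (2 <= size vs)%N, uniq es, uniq vs,
      all (fun e => e \in F) es &
      all (fun p => joins ends p.1 p.2.1 p.2.2) (zip es (zip vs (rot 1 vs)))].

Definition acyclic (n m : nat) (ends : 'I_m -> 'I_n * 'I_n) (F : {set 'I_m}) : Prop :=
  forall (es : seq 'I_m) (vs : seq 'I_n), ~~ is_cycle_in ends F es vs.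

Definition wsum (m : nat) (w : 'I_m -> R) (F : {set 'I_m}) : R := \sum_(e in F) w e.

(* OPT(G): maximum weight of an acyclic edge set (the empty set is acyclic and
   weights are nonnegative, so 0 is a harmless initial value). *)
Definition OPT (n m : nat) (ends : 'I_m -> 'I_n * 'I_n) (w : 'I_m -> R) : R :=
  \big[Num.max/0]_(F : {set 'I_m} | `[< acyclic ends F >]) wsum w F.

Definition obs (n : nat) := ('I_n * 'I_n * R)%type.

(* A randomized online algorithm, in behavioural form: knowing n = |V| and m,
   given the history of previous observations together with its own previous
   decisions (true = accepted) and the current observation, it returns the
   probability with which it accepts the current edge. *)
Definition online_alg := forall n m : nat, seq (obs n * bool) -> obs n -> R.

Definition valid_alg (alg : online_alg) : Prop :=
  forall n m (h : seq (obs n * bool)) (o : obs n), 0 <= alg n m h o <= 1.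

Section Run.
Variables (alg : online_alg) (n m : nat) (ends : 'I_m -> 'I_n * 'I_n) (w : 'I_m -> R).
Arguments alg : clear implicits.
Variables (sigma : {perm 'I_m}) (d : {ffun 'I_m -> bool}).

Definition obs_of (e : 'I_m) : obs n := ((ends e).1, (ends e).2, w e).

(* One time step t: edge sigma t arrives.  The state is
   (history, accepted set, probability of the coin outcomes so far).
   The coin outcome d t says whether the algorithm accepts; accepting an edge
   that would close a cycle is not allowed, so such an edge is accepted with
   probability 0. *)
Definition step (st : seq (obs n * bool) * {set 'I_m} * R) (t : 'I_m)
  : seq (obs n * bool) * {set 'I_m} * R :=
  let: (h, A, pr) := st in
  let e := sigma t in
  let o := obs_of e in
  let feas := `[< acyclic ends (e |: A) >] in
  let pacc := if feas then alg n m h o else 0 in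
  let b := d t && feas in
  (rcons h (o, b), (if b then e |: A else A),
   pr * (if d t then pacc else 1 - pacc)).

Definition run := foldl step ([::], set0, 1) (enum 'I_m).

End Run.

Definition expected_ALG (alg : online_alg) (n m : nat)
    (ends : 'I_m -> 'I_n * 'I_n) (w : 'I_m -> R) : R :=
  (m`!)%:R^-1 *
  \sum_(sigma : {perm 'I_m}) \sum_(d : {ffun 'I_m -> bool})
     let: (_, A, pr) := run alg ends w sigma d in pr * wsum w A.

(* Main.v *)
(** Sample the first half of the arrivals.  Afterwards, at every step compute
    the greedy maximum-weight forest T of the edges seen so far and orient it
    away from a root in each component, so that every vertex has at most one
    in-edge.  The arriving edge is accepted if it belongs to T and both its
    endpoints are unblocked, and then its head becomes blocked.  In addition, at
    step k each vertex without in-edge in T is blocked with probability 1/(2k);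
    this dummy blocking is what beats the ratio 4.

    Read backwards, the last of k arrivals is uniform, so a given pair {u, v} of
    endpoints survives step k with probability at least 1 - 2/k, and half of
    the time as sample yields 1/4.  The gain: the in-edges of u and v are not
    parallel, so one of them comes from a third vertex y; if y is already blocked
    (through its own in-edge, or through a dummy if it has none) this in-edge
    is rejected and does no harm.  This lifts the acceptance probability of each
    edge of the optimal forest from 1/4 to about 0.257.

    Ties are broken by random labels.  The private randomness (labels and coins)
    is finally integrated out by Bayes' rule, which turns the mixture of
    deterministic algorithms into acceptance probabilities given the history. *)

Require Import Defs.
From Stdlib Require Import Reals.
From HB Require Import structures.
From mathcomp Require Import all_boot all_order all_algebra all_fingroup.
From mathcomp Require Import boolp Rstruct.
From mathcomp Require Import zify ring lra.
Import Order.TTheory GRing.Theory Num.Theory.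
Local Open Scope ring_scope.

Set Implicit Arguments.
Unset Strict Implicit.
Unset Printing Implicit Defensive.

(** * Greedy forests *)

Section Forest.
Variables (n : nat) (T : eqType) (ed : T -> 'I_n * 'I_n) (gt : rel T).
Implicit Types (R S F : seq T) (x y f g : T) (a b c r : 'I_n).

Definition adj R : rel 'I_n :=
  fun a b => has (fun x => (ed x == (a, b)) || (ed x == (b, a))) R.
Definition con R : rel 'I_n := connect (adj R).

Lemma adj_sym R : symmetric (adj R).
Proof. by move=> a b; apply: eq_has => x; rewrite orbC. Qed.

Lemma con_symr R : connect_sym (adj R).
Proof. exact: (sym_connect_sym (@adj_sym R)). Qed.

Lemma con_sym R a b : con R a b = con R b a.
Proof. exact: con_symr. Qed.

Lemma con_trans R a b c : con R a b -> con R b c -> con R a c.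
Proof. exact: connect_trans. Qed.

Lemma con_edge R x : x \in R -> con R (ed x).1 (ed x).2.
Proof.
move=> xR; apply: connect1; apply/hasP; exists x => //.
by rewrite -surjective_pairing eqxx.
Qed.

Lemma con_via R S a b :
  (forall x, x \in R -> con S (ed x).1 (ed x).2) -> con R a b -> con S a b.
Proof.
move=> RS; apply: connect_sub => {}a {}b /hasP[x xR].
by case/orP=> /eqP ex; have := RS _ xR; rewrite ex //= con_sym.
Qed.

Lemma con_mono R S a b : {subset R <= S} -> con R a b -> con S a b.
Proof. by move=> RS; apply: con_via => x /RS; apply: con_edge. Qed.

Lemma con_eq R S : R =i S -> con R =2 con S.
Proof.
by move=> RS a b; apply/idP/idP; apply: con_mono => x; rewrite RS.
Qed.

Lemma con_cons x R a b : con (x :: R) a b ->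
  [|| con R a b, con R a (ed x).1 && con R (ed x).2 b
    | con R a (ed x).2 && con R (ed x).1 b].
Proof.
case/connectP=> p; elim: p a => [|c p IHp] a /=.
  by move=> _ ->; rewrite [con _ _ _]connect0.
case/andP=> ac /IHp{}IHp /IHp{IHp}cb.
case/orP: ac => [|ac]; last first.
  have {}ac : con R a c by apply: connect1.
  case/or3P: cb => [cb|/andP[cu vb]|/andP[cv ub]].
  - by rewrite (con_trans ac cb).
  - by rewrite (con_trans ac cu) vb orbT.
  - by rewrite (con_trans ac cv) ub !orbT.
case/orP=> /eqP ex; rewrite ex /= in cb *.
  case/or3P: cb => [cb|/andP[_ cb]|/andP[_ ->]//].
    by rewrite cb /con connect0 orbT.
  by rewrite cb /con connect0 orbT.
case/or3P: cb => [cb|/andP[_ ->]//|/andP[_ cb]].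
  by rewrite cb /con connect0 !orbT.
by rewrite cb /con connect0 !orbT.
Qed.

Definition without x R := [seq y <- R | y != x].

Lemma mem_without x R y : (y \in without x R) = (y != x) && (y \in R).
Proof. by rewrite mem_filter. Qed.

Lemma con_without x R a b : con R a b ->
  [|| con (without x R) a b,
      con (without x R) a (ed x).1 && con (without x R) (ed x).2 b
    | con (without x R) a (ed x).2 && con (without x R) (ed x).1 b].
Proof.
move=> Rab; apply: con_cons; apply: con_mono Rab => y yR.
by rewrite inE mem_without yR andbT orbN.
Qed.

Definition forest F := forall x, x \in F -> ~~ con (without x F) (ed x).1 (ed x).2.

Definition heavier R x := [seq y <- R | gt y x].
(** Kruskal's rule as a local test. It depends only on the set of edges, not on their order in the
    list, which the backward analysis relies on. *)
Definition in_tree R x := (x \in R) && ~~ con (heavier R x) (ed x).1 (ed x).2.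
Definition tree R := filter (in_tree R) R.

Lemma mem_tree R x : (x \in tree R) = in_tree R x.
Proof. by rewrite mem_filter /in_tree; case: (x \in R); rewrite ?andbF ?andbT. Qed.

Lemma tree_sub R : {subset tree R <= R}.
Proof. by move=> x; rewrite mem_tree => /andP[]. Qed.

Lemma heavier_sub R S x : {subset R <= S} -> {subset heavier R x <= heavier S x}.
Proof. by move=> RS y; rewrite !mem_filter => /andP[-> /RS]. Qed.

(** Fewer competing edges leave fewer connections. So an edge of the final tree belongs to the
    current tree at the moment it arrives. *)
Lemma in_tree_sub R S x : {subset R <= S} -> x \in R -> in_tree S x -> in_tree R x.
Proof.
move=> RS xR /andP[_ nc]; rewrite /in_tree xR; apply: contra nc.
exact/con_mono/heavier_sub.
Qed.

Lemma eq_in_tree R S : R =i S -> in_tree R =1 in_tree S.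
Proof.
move=> RS x; rewrite /in_tree RS; congr (_ && ~~ _); apply: con_eq => y.
by rewrite !mem_filter RS.
Qed.

Lemma eq_tree R S : R =i S -> tree R =i tree S.
Proof. by move=> RS x; rewrite !mem_tree; apply: eq_in_tree. Qed.

(** Totality is asked on [R] only: labels separate the edges that occur, not arbitrary labelled
    observations. *)
Definition strict_order_on R := 
  [/\ irreflexive gt, transitive gt &
      {in R &, forall x y, x != y -> gt x y || gt y x}].

Section Ordered.
Variable R : seq T.
Hypothesis ordR : strict_order_on R.

Lemma lightest S : S != [::] -> {subset S <= R} ->
  exists2 y, y \in S & forall z, z \in S -> z != y -> gt z y.
Proof.
have [_ tr tot] := ordR.
elim: S => // x S IHS _ SR.
have xR : x \in R by apply: SR; rewrite mem_head.
case: (S =P [::]) => [->|/eqP nS].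
  by exists x; rewrite ?mem_head // => z; rewrite inE => ->.
have [y yS ylt] := IHS nS (fun z zS => SR z (mem_behead (s := x :: S) zS)).
have yR : y \in R by apply: SR; rewrite inE yS orbT.
have [xy|xy] := eqVneq x y.
  exists y; rewrite ?inE ?yS ?orbT // => z; rewrite inE xy.
  by case/orP=> [->//|]; apply: ylt.
case/orP: (tot _ _ xR yR xy) => [gxy|gyx].
  exists y; rewrite ?inE ?yS ?orbT // => z; rewrite inE.
  by case/orP=> [/eqP->//|]; apply: ylt.
exists x; rewrite ?mem_head // => z; rewrite inE => /orP[->//|zS _].
have [->//|zy] := eqVneq z y.
exact: tr (ylt _ zS zy) gyx.
Qed.

(** Induction on the number of edges heavier than [x]: a heavier edge outside the tree has its ends
    connected by edges heavier than itself, and these are fewer. *)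
Lemma con_heavier_tree x a b : con (heavier R x) a b -> con (heavier (tree R) x) a b.
Proof.
have [irr tr _] := ordR.
have [k] := ubnP (size (heavier R x)); elim: k x a b => // k IHk x a b.
rewrite ltnS => szk; apply: con_via => y; rewrite mem_filter => /andP[gyx yR].
have [yT|] := boolP (in_tree R y).
  by apply: con_edge; rewrite mem_filter gyx mem_tree.
rewrite /in_tree yR negbK /= => /IHk cT.
apply: con_mono (cT _) => [z|].
  by rewrite !mem_filter => /andP[gzy ->]; rewrite (tr _ _ _ gzy gyx).
apply: leq_trans szk.
have -> : heavier R y = [seq z <- heavier R x | gt z y].
  rewrite /heavier -filter_predI; apply: eq_filter => z /=.
  by case: (boolP (gt z y)) => //= zy; rewrite (tr _ _ _ zy gyx).
rewrite size_filter ltn_neqAle count_size andbT -all_count.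
by apply/allPn; exists y; rewrite ?irr // mem_filter gyx.
Qed.

(** In a hypothetical cycle inside [x :: S] the lightest edge [y] has its ends connected by the
    heavier others, against the greedy rule. The list [S] may contain edges off the cycle; if [y] is
    one of them, it is dropped by induction. *)
Lemma forest_tree : forest (tree R).
Proof.
move=> x xT; have [irr _ _] := ordR.
have sub S : {subset S <= without x (tree R)} -> ~~ con S (ed x).1 (ed x).2.
  have [k] := ubnP (size S); elim: k S => // k IHk S; rewrite ltnS => szS ST.
  apply/negP => cS.
  have TR : {subset x :: S <= R}.
    move=> z; rewrite inE => /orP[/eqP->|/ST]; first exact: tree_sub.
    by rewrite mem_without => /andP[_ /tree_sub].
  have [//|y yS ylt] := lightest _ TR.
  have hvy z : z \in x :: S -> z != y -> z \in heavier R y.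
    by move=> zS zy; rewrite mem_filter ylt // TR.
  have [yx|yx] := eqVneq y x.
    move: xT; rewrite mem_tree => /andP[_ /negP[]]; apply: con_mono cS => z zS.
    rewrite -yx; apply: hvy; first by rewrite inE zS orbT.
    by move/ST: zS; rewrite mem_without yx => /andP[].
  have {}yS : y \in S by move: yS; rewrite inE (negPf yx).
  have yT : y \in tree R by move/ST: (yS); rewrite mem_without => /andP[].
  have nc : ~~ con (without y S) (ed x).1 (ed x).2.
    apply: IHk => [|z].
      apply: leq_trans szS; rewrite size_filter ltn_neqAle count_size andbT.
      by rewrite -all_count; apply/allPn; exists y; rewrite ?eqxx.
    by rewrite mem_without => /andP[_ /ST].
  have cx : con (x :: without y S) (ed y).1 (ed y).2.
    have cxS a b : con (without y S) a b -> con (x :: without y S) a b.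
      by apply: con_mono => z zS; rewrite inE zS orbT.
    have cxx : con (x :: without y S) (ed x).1 (ed x).2 by rewrite con_edge ?mem_head.
    case/or3P: (con_without y cS) => [cc|/andP[/cxS c1 /cxS c2]|/andP[/cxS c1 /cxS c2]].
    - by rewrite cc in nc.
    - by rewrite con_sym in c1; rewrite con_sym in c2; exact: con_trans (con_trans c1 cxx) c2.
    - by rewrite con_sym in cxx; exact: con_trans (con_trans c2 cxx) c1.
  move: yT; rewrite mem_tree => /andP[_ /negP[]]; apply: con_mono cx => z.
  rewrite inE mem_without => /orP[/eqP->|/andP[zy zS]].
    by apply: hvy; rewrite ?mem_head // eq_sym.
  by apply: hvy; rewrite ?inE ?zS ?orbT.
exact: sub.
Qed.

End Ordered.
End Forest.

(** * Orientation and optimality of the greedy forest *)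

Section Heads.
Variables (n : nat) (T : eqType) (ed : T -> 'I_n * 'I_n) (gt : rel T).
Implicit Types (R S F : seq T) (x y f g : T) (a b c r w : 'I_n).
Notation con := (con ed).
Notation tree := (tree ed gt).

Definition ends_of x : pred 'I_n := pred2 (ed x).1 (ed x).2.

Definition tree_root R a := fingraph.root (adj ed (tree R)) a.

(** Deleting a tree edge cuts one of its endpoints off from the root; that endpoint is the head. The
    root is the canonical representative [fingraph.root], so the orientation, too, is a function of
    the edge set. *)
Definition ehead R x :=
  if con (without x (tree R)) (tree_root R (ed x).1) (ed x).1
  then (ed x).2 else (ed x).1.

Definition etail R x := if ehead R x == (ed x).1 then (ed x).2 else (ed x).1.

Lemma ehead_ends R x : ehead R x \in ends_of x.
Proof. by rewrite /ehead !inE; case: ifP; rewrite eqxx ?orbT. Qed.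

Lemma ends_ehead_etail R x a : (ed x).1 != (ed x).2 ->
  (a \in ends_of x) = (a == ehead R x) || (a == etail R x).
Proof.
rewrite /etail /ehead !inE => nl; case: ifP => _; last by rewrite eqxx.
by rewrite [(ed x).2 == (ed x).1]eq_sym (negPf nl) orbC.
Qed.

Lemma eq_ehead R S : R =i S -> ehead R =1 ehead S.
Proof.
move=> RS x; have TRS := eq_tree ed gt RS; rewrite /ehead /tree_root.
have -> : fingraph.root (adj ed (tree R)) (ed x).1 = fingraph.root (adj ed (tree S)) (ed x).1.
  by apply: eq_root => a b; apply: eq_has_r.
rewrite (@con_eq _ _ _ (without x (tree R)) (without x (tree S))) // => y.
by rewrite !mem_without TRS.
Qed.

Lemma tree_rootP R a b : con (tree R) a b -> tree_root R a = tree_root R b.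
Proof.
by move=> ab; apply/eqP; rewrite root_connect //; exact: con_symr.
Qed.

Variable R : seq T.
Hypotheses (ordR : strict_order_on gt R)
  (loopR : forall x, x \in R -> (ed x).1 != (ed x).2).

Lemma ehead_spec x : x \in tree R -> let r := tree_root R (ehead R x) in
  [/\ con (without x (tree R)) r (etail R x),
      ~~ con (without x (tree R)) r (ehead R x),
      con (tree R) (ehead R x) (etail R x) &
      (forall S, x \in S -> con S (ehead R x) (etail R x))].
Proof.
move=> xT; have nl := loopR (tree_sub xT).
have cS S : x \in S -> con S (ehead R x) (etail R x).
  move=> xS; rewrite /etail /ehead; case: ifP => _; last by rewrite eqxx con_edge.
  by rewrite eq_sym (negPf nl) con_sym con_edge.
have r12 := tree_rootP (con_edge ed xT).
have nc := forest_tree ordR xT.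
have cr : con (tree R) (tree_root R (ed x).1) (ed x).1.
  by rewrite con_sym; apply: connect_root.
move=> r; have re : r = tree_root R (ed x).1.
  by rewrite /r /ehead; case: ifP => // _; rewrite r12.
rewrite re; split; last exact: cS; last by apply: cS.
  rewrite /etail /ehead.
  have [cc|nr] := boolP (con (without x (tree R)) (tree_root R (ed x).1) (ed x).1).
    by rewrite [(ed x).2 == (ed x).1]eq_sym (negPf nl).
  rewrite eqxx; case/or3P: (con_without x cr) => [cc|/andP[cc _]|/andP[cc _] //].
    by rewrite cc in nr.
  by rewrite cc in nr.
rewrite /ehead; case: ifP => [cc|->//]; apply: contra nc => cc2.
by rewrite con_sym in cc; exact: con_trans cc cc2.
Qed.

(** Suppose two tree edges enter the same vertex. The root reaches the tail of [x] without [x], and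
    also without [y], since touching [y] would lead to the common head without [x]. Following [x]
    then enters that head without [y], a contradiction. *)
Lemma ehead_inj x y : x \in tree R -> y \in tree R -> ehead R x = ehead R y -> x = y.
Proof.
move=> xT yT hxy; apply/eqP/negPn/negP => xy.
have [x1 x2 _ x4] := ehead_spec xT; have [y1 y2 _ y4] := ehead_spec yT.
rewrite -hxy in y1 y2 y4.
move: x1 x2 y1 y2; set r := tree_root R _; set w := ehead R x => x1 x2 y1 y2.
have sx z : z \in without y (without x (tree R)) -> z \in without x (tree R).
  by rewrite mem_without => /andP[].
have sy z : z \in without y (without x (tree R)) -> z \in without y (tree R).
  by rewrite !mem_without => /and3P[-> _ ->].
have yx : y \in without x (tree R) by rewrite mem_without eq_sym xy.
have xy' : x \in without y (tree R) by rewrite mem_without xy.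
have cyx := y4 _ yx; have cxy := x4 _ xy'.
rewrite -/w in cyx cxy.
have xr : con (without y (without x (tree R))) r (etail R x).
  have [//|/negP[]] := boolP (con (without y (without x (tree R))) r (etail R x)).
  have nw z : con (without y (without x (tree R))) r z -> z \in ends_of y -> False.
    rewrite (ends_ehead_etail R) ?loopR ?(tree_sub yT) // -hxy -/w => rz /orP[] /eqP zz.
      by move/negP: x2; apply; rewrite -zz; apply: con_mono rz.
    move/negP: x2; apply; rewrite con_sym; apply: con_trans cyx _.
    by rewrite con_sym -zz; apply: con_mono rz.
  case/or3P: (con_without y x1) => [//|/andP[c1 _]|/andP[c1 _]].
    by case: (nw _ c1); rewrite !inE eqxx.
  by case: (nw _ c1); rewrite !inE eqxx orbT.
move/negP: y2; apply; rewrite con_sym; apply: con_trans cxy _.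
by rewrite con_sym; apply: con_mono xr.
Qed.

(** Complements [ehead_inj]: parallel tree edges would have equal or opposite orientations. In the
    opposite case the root reaches the tail of [x] without [x], and [y] leads on to its head. *)
Lemma tree_simple x y : x \in tree R -> y \in tree R ->
  ehead R x = etail R y -> etail R x = ehead R y -> x = y.
Proof.
move=> xT yT hx tx; apply/eqP/negPn/negP => xy.
have [x1 x2 _ _] := ehead_spec xT; have [_ _ _ y4] := ehead_spec yT.
move/negP: x2; apply; apply: con_trans x1 _; rewrite hx tx.
by apply: y4; rewrite mem_without eq_sym xy.
Qed.

Section Optimal.
Variable wt : T -> Rdefinitions.R.
Hypotheses (wt0 : forall x, 0 <= wt x)
  (wt_gt : forall x y, gt x y -> wt y <= wt x).

Lemma forest_add F g : forest ed F -> ~~ con F (ed g).1 (ed g).2 ->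
  forest ed (g :: F).
Proof.
move=> fF nc x; rewrite inE; have [->|xg] := eqVneq x g.
  move=> _; apply: contra nc; apply: con_mono => y.
  by rewrite mem_without inE; case: eqP.
rewrite orFb => xF; apply/negP => cc.
have nx := fF _ xF.
have {}cc : con (g :: without x F) (ed x).1 (ed x).2.
  apply: con_mono cc => z; rewrite mem_without !inE mem_without.
  by case/andP=> -> /orP[->//|->]; rewrite orbT.
have cF a b : con (without x F) a b -> con F a b.
  by apply: con_mono => z; rewrite mem_without => /andP[].
have cx := con_edge ed xF.
case/or3P: (con_cons cc) => [c0|/andP[/cF c1 /cF c2]|/andP[/cF c1 /cF c2]].
- by rewrite c0 in nx.
- move/negP: nc; apply; rewrite con_sym in c1; rewrite con_sym in c2.
  exact: con_trans (con_trans c1 cx) c2.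
- move/negP: nc; apply; rewrite con_sym in cx.
  exact: con_trans (con_trans c2 cx) c1.
Qed.

Lemma forest_sub F S : {subset S <= F} -> forest ed F -> forest ed S.
Proof.
move=> SF fF x xS; apply: contra (fF _ (SF _ xS)); apply: con_mono => z.
by rewrite !mem_without => /andP[-> /SF].
Qed.

(* Exchange: an edge f of F outside the greedy tree can be traded for a heavier
   tree edge reconnecting the two sides of F - f. *)
Lemma forest_weight F : uniq R -> uniq F -> {subset F <= R} -> forest ed F ->
  \sum_(x <- F) wt x <= \sum_(x <- tree R) wt x.
Proof.
move=> uR; have [k] := ubnP (count (fun x => x \notin tree R) F).
elim: k F => // k IHk F; rewrite ltnS => cF uF FR fF.
have uT : uniq (tree R) by rewrite filter_uniq.
have [/allP FT|/allPn[f fF' fT]] := boolP (all (mem (tree R)) F).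
  have -> : \sum_(x <- F) wt x = \sum_(x <- tree R | x \in F) wt x.
    rewrite -[RHS]big_filter; apply: perm_big; apply: uniq_perm => //.
      by rewrite !filter_uniq.
    move=> x; rewrite mem_filter; apply/idP/andP => [xF|[]//].
    by split=> //; apply: FT.
  rewrite [leRHS](bigID (fun x => x \in F)) /= lerDl.
  by apply: sumr_ge0.
have fR := FR _ fF'.
have ncf := fF _ fF'.
(* By [con_heavier_tree] heavier tree edges connect the ends of [f]; if [F] without [f] connected
   the ends of each of them, [f] would close a cycle in [F]. *)
have /hasP[g gT ncg] : has (fun g => ~~ con (without f F) (ed g).1 (ed g).2)
    (heavier gt (tree R) f).
  apply/negPn/negP => /hasPn allc; move/negP: ncf; apply.
  have cT : con (heavier gt (tree R) f) (ed f).1 (ed f).2.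
    apply: (con_heavier_tree ordR).
    by move: fT; rewrite inE mem_tree /in_tree fR /= negbK.
  by apply: con_via cT => x /allc; rewrite negbK.
move: gT; rewrite mem_filter => /andP[gf gT].
have gF : g \notin without f F.
  by apply: contra ncg => gF; apply: con_edge.
have subF : {subset without f F <= F} by move=> z; rewrite mem_without => /andP[].
have := IHk (g :: without f F).
have pF : perm_eq F (f :: without f F).
  have -> : without f F = rem f F by rewrite rem_filter.
  exact: perm_to_rem.
rewrite (perm_big _ pF) /= !big_cons => H.
apply: le_trans (H _ _ _ _) => {H}.
- by rewrite lerD2r wt_gt.
- rewrite /= gT add0n; apply: leq_trans cF.
  by rewrite (seq.permP pF) /= fT.
- by rewrite /= gF filter_uniq.
- by move=> z; rewrite inE => /orP[/eqP->|/subF/FR//]; apply: tree_sub gT.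
- by apply: forest_add => //; apply: forest_sub fF.
Qed.

End Optimal.
End Heads.

(** * Cycles *)

Section Cycles.
Variables (n m : nat) (ends : 'I_m -> 'I_n * 'I_n).
Hypothesis loop : loopless ends.
Variables (T : eqType) (ed : T -> 'I_n * 'I_n) (L : 'I_m -> T).
Hypothesis edL : forall e, ed (L e) = ends e.
Hypothesis injL : injective L.

Definition edges (S : {set 'I_m}) : seq T := [seq L e | e <- enum S].

Lemma mem_edges (S : {set 'I_m}) e : (L e \in edges S) = (e \in S).
Proof. by rewrite mem_map // mem_enum. Qed.

Lemma edgesP (S : {set 'I_m}) x : reflect (exists2 e, e \in S & x = L e) (x \in edges S).
Proof.
by apply: (iffP mapP) => -[e eS ->]; exists e; rewrite // mem_enum in eS *.
Qed.

Lemma uniq_edges (S : {set 'I_m}) : uniq (edges S).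
Proof. by rewrite map_inj_uniq // enum_uniq. Qed.

Lemma path_edges (S : {set 'I_m}) a p : path (adj ed (edges S)) a p -> uniq (a :: p) ->
  exists es, [/\ size es = size p, uniq es, {subset es <= S},
    all (fun q => joins ends q.1 q.2.1 q.2.2) (zip es (zip (belast a p) p)) &
    all (fun e => ((ends e).1 \in a :: p) && ((ends e).2 \in a :: p)) es].
Proof.
elim: p a => [|b p IHp] a; first by exists [::].
rewrite [path _ _ _]/= => /andP[/hasP[x /edgesP[e eS ->]] ab] /IHp{}IHp /andP[ap uq].
have [es [sz ues sub jo inn]] := IHp uq.
have jab : joins ends e a b by rewrite /joins -edL.
exists (e :: es); split => /=.
- by rewrite sz.
- rewrite ues andbT; apply: contra ap => /(allP inn) /andP[].
  by case/orP: jab => /eqP ->.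
- by move=> f; rewrite inE => /orP[/eqP->|/sub].
- by rewrite jab.
- apply/andP; split.
    by case/orP: jab => /eqP -> /=; rewrite !inE !eqxx ?orbT.
  apply/allP => f /(allP inn) /andP[f1 f2].
  by rewrite inE f1 orbT inE f2 orbT.
Qed.

(** If [F] without [e] connects the ends of [e], a simple path between them is closed by [e] to a
    cycle in the sense of [is_cycle_in]. *)
Lemma acyclic_forest (F : {set 'I_m}) : acyclic ends F -> forest ed (edges F).
Proof.
move=> acF x /edgesP[e eF ->{x}]; apply/negP => cc.
have {}cc : con ed (edges (F :\ e)) (ends e).1 (ends e).2.
  rewrite -edL; apply: con_mono cc => x; rewrite mem_without => /andP[xe /edgesP[f fF xf]].
  rewrite xf mem_edges !inE fF andbT; apply: contraNneq xe => fe.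
  by rewrite xf fe.
case/connectP: cc => p0 /shortenP[p pp up _] lastp.
have [es [sz ues sub jo _]] := path_edges pp up.
suff cF : is_cycle_in ends F (rcons es e) ((ends e).1 :: p).
  by rewrite (negPf (acF _ _)) in cF.
have pn : p != [::].
  by apply: contraNneq (loop e) => p0'; rewrite lastp p0' /=.
rewrite /is_cycle_in size_rcons sz eqxx /= ltnS lt0n size_eq0 pn /=.
rewrite rcons_uniq ues andbT; apply/and4P; split.
- by apply/negP => /sub; rewrite !inE eqxx.
- exact: up.
- rewrite all_rcons eF; apply/allP => f /sub.
  by rewrite !inE => /andP[].
rewrite rot1_cons lastI -!cats1.
rewrite zip_cat ?size_belast // zip_cat; last by rewrite size_zip size_belast minnn.
rewrite all_cat jo /= -lastp andbT /joins.
by rewrite -surjective_pairing; case: (ends e) => ? ?; rewrite eqxx orbT.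
Qed.

Lemma zip_joinsP es us vs f : size us = size es -> size vs = size es ->
  all (fun q => joins ends q.1 q.2.1 q.2.2) (zip es (zip us vs)) -> f \in es ->
  exists a b, [/\ a \in us, b \in vs & joins ends f a b].
Proof.
elim: es us vs => [|g es IH] [|u us] [|v vs] //= [su] [sv] /andP[jg /IH{}IH].
rewrite inE => /orP[/eqP->|/(IH su sv)[a [b [au bv ab]]]].
  by exists u, v; rewrite !mem_head.
by exists a, b; rewrite !inE au bv !orbT.
Qed.

(* A cycle through the new edge e has one vertex per edge; its other edges have
   distinct heads on the cycle, none of which is an endpoint of e. *)
Lemma acyclic_add (A : {set 'I_m}) (e : 'I_m) (hd : 'I_m -> 'I_n) :
  acyclic ends A -> {in A &, injective hd} ->
  (forall f, f \in A -> hd f \in pred2 (ends f).1 (ends f).2) ->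
  (forall f, f \in A -> hd f \notin pred2 (ends e).1 (ends e).2) ->
  acyclic ends (e |: A).
Proof.
move=> acA hinj hends hne es vs; apply/negP => cyc.
have /and5P[/eqP sz szv ues uvs /andP[sub jo]] := cyc.
have inv f : f \in es -> ((ends f).1 \in vs) && ((ends f).2 \in vs).
  have sr : size (rot 1 vs) = size es by rewrite size_rot.
  case/(zip_joinsP (esym sz) sr jo) => a [b [av]]; rewrite mem_rot => bv.
  by case/orP => /eqP -> /=; rewrite av bv.
have subA f : f \in rem e es -> f \in A.
  rewrite mem_rem_uniq // !inE => /andP[fe fes].
  by move/allP: sub => /(_ _ fes); rewrite !inE (negPf fe).
have ees : e \in es.
  apply: contraT => ees.
  suff cA : is_cycle_in ends A es vs by rewrite (negPf (acA es vs)) in cA.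
  rewrite /is_cycle_in sz eqxx szv ues uvs jo /= andbT.
  by apply/allP => f fes; apply: subA; rewrite rem_id.
have /andP[uv1 uv2] := inv _ ees.
have uh : uniq [seq hd f | f <- rem e es].
  by rewrite map_inj_in_uniq ?rem_uniq // => f g /subA fA /subA gA; apply: hinj.
have /(uniq_leq_size uh) : {subset [seq hd f | f <- rem e es]
    <= rem (ends e).1 (rem (ends e).2 vs)}.
  move=> w /mapP[f fr ->{w}]; have fA := subA _ fr.
  rewrite mem_rem_uniq ?rem_uniq // inE mem_rem_uniq // inE.
  have := hne _ fA; rewrite !inE negb_or => /andP[-> ->] /=.
  have /andP[f1 f2] := inv _ (mem_rem fr).
  by have := hends _ fA; rewrite !inE => /orP[] /eqP ->.
have s1 : size (rem e es) = (size vs).-1 by rewrite size_rem ?sz.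
have s2 : size (rem (ends e).2 vs) = (size vs).-1 by rewrite size_rem.
have s3 : size (rem (ends e).1 (rem (ends e).2 vs)) = (size vs).-2.
  by rewrite size_rem ?s2 // mem_rem_uniq // inE loop uv1.
rewrite size_map s1 s3; case: (size vs) szv => [|[|k]] //= _.
by rewrite ltnn.
Qed.
End Cycles.

(** * The algorithm *)

Section Machine.
Variables (n : nat) (T : eqType) (ed : T -> 'I_n * 'I_n) (gt : rel T) (p : nat).

Definition coins := {ffun 'I_n -> bool}.

Definition has_in (R : seq T) (w : 'I_n) : bool :=
  has (fun x => ehead ed gt R x == w) (tree ed gt R).

Definition accepts (st : seq T * {set 'I_n}) (x : T) : bool :=
  [&& (p <= size st.1)%N, x \in tree ed gt (x :: st.1),
      (ed x).1 \notin st.2 & (ed x).2 \notin st.2].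

(** A rejected edge leaves its head unblocked. The blocked set never shrinks, although the tree and
    its orientation may change with every arrival. *)
Definition mstep (st : seq T * {set 'I_n}) (x : T) (Z : coins) : seq T * {set 'I_n} :=
  (x :: st.1,
   [set w | [|| w \in st.2,
                [&& (p <= size st.1)%N, Z w & ~~ has_in (x :: st.1) w] |
                accepts st x && (w == ehead ed gt (x :: st.1) x)]]).

End Machine.

(** * Expectations over the dummy coins *)

Section Coins.
Variables (F : realFieldType) (n : nat).
Local Notation coins := (coins n).
Implicit Types (k : nat) (f : coins -> F) (W : {set 'I_n}).

Definition coin_rate k : F := (2 * k)%:R^-1.
Definition coin_weight k (Z : coins) : F :=
  \prod_w (if Z w then coin_rate k else 1 - coin_rate k).
Definition EZ k f : F := \sum_(Z : coins) coin_weight k Z * f Z.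

Lemma coin_rate_bounds k : (0 < k)%N ->
  [/\ 0 <= coin_rate k, coin_rate k <= k%:R^-1 & coin_rate k <= 1 / 2%:R].
Proof.
move=> k0; rewrite /coin_rate; have k1 : (1 : F) <= k%:R by rewrite ler1n.
split; first by rewrite invr_ge0.
  by rewrite lef_pV2 ?posrE ?ltr0n ?muln_gt0 // ler_nat; lia.
by rewrite mul1r lef_pV2 ?posrE ?ltr0n ?muln_gt0 // ler_nat; lia.
Qed.

Lemma coin_weight_ge0 k Z : (0 < k)%N -> 0 <= coin_weight k Z.
Proof.
by case/coin_rate_bounds => d0 _ d1; apply: prodr_ge0 => w _; case: (Z w); lra.
Qed.

Lemma EZ_prod k (f : 'I_n -> bool -> F) :
  EZ k (fun Z => \prod_w f w (Z w)) =
  \prod_w (coin_rate k * f w true + (1 - coin_rate k) * f w false).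
Proof.
rewrite /EZ (eq_bigr (fun w => \sum_(b : bool) (if b then coin_rate k else 1 - coin_rate k) * f w b)).
  rewrite bigA_distr_bigA; apply: eq_bigr => Z _.
  by rewrite big_split.
by move=> w _; rewrite big_bool.
Qed.

Lemma EZ_le k f g : (0 < k)%N -> (forall Z, f Z <= g Z) -> EZ k f <= EZ k g.
Proof.
by move=> k0 fg; apply: ler_sum => Z _; apply: ler_wpM2l; rewrite ?coin_weight_ge0.
Qed.

Definition no_coin W (Z : coins) : F := [forall w in W, ~~ Z w]%:R.

Lemma no_coinE W Z : no_coin W Z = \prod_w (if w \in W then (~~ Z w)%:R else 1).
Proof.
rewrite /no_coin; have [/forall_inP H|] := boolP [forall w in W, ~~ Z w].
  by rewrite big1 // => w _; case: ifP => // /H ->.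
case/forallPn => w; rewrite negb_imply negbK => /andP[wW Zw].
by rewrite (bigD1 w) //= wW Zw mul0r.
Qed.

Lemma EZ_cst k (c : F) : EZ k (fun=> c) = c.
Proof.
rewrite -[LHS]/(\sum_Z coin_weight k Z * c) -mulr_suml.
suff -> : \sum_Z coin_weight k Z = 1 by rewrite mul1r.
have := EZ_prod k (fun _ _ => 1); rewrite /EZ.
rewrite [RHS]big1; last by move=> w _; rewrite !mulr1 addrC subrK.
move=> <-; apply: eq_bigr => Z _; rewrite [X in _ * X]big1 ?mulr1 //.
Qed.

Lemma EZ_no_coin k W : EZ k (no_coin W) = (1 - coin_rate k) ^+ #|W|.
Proof.
pose f w (b : bool) : F := if w \in W then (~~ b)%:R else 1.
have -> : EZ k (no_coin W) = EZ k (fun Z => \prod_w f w (Z w)).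
  by apply: eq_bigr => Z _; rewrite no_coinE.
rewrite EZ_prod /f.
rewrite -prodr_const [RHS]big_mkcond; apply: eq_bigr => w _.
by case: ifP; rewrite /= ?mulr0 ?mulr1 ?add0r // addrC subrK.
Qed.

Lemma EZ_one_coin k W y : y \notin W ->
  EZ k (fun Z => (Z y)%:R * no_coin W Z) = coin_rate k * (1 - coin_rate k) ^+ #|W|.
Proof.
move=> yW; pose f w (b : bool) : F :=
  if w == y then b%:R else if w \in W then (~~ b)%:R else 1.
have -> : EZ k (fun Z => (Z y)%:R * no_coin W Z) = EZ k (fun Z => \prod_w f w (Z w)).
  apply: eq_bigr => Z _; congr (_ * _); rewrite no_coinE.
  rewrite (bigD1 y) //= (negPf yW) mul1r [RHS](bigD1 y) //= /f eqxx; congr (_ * _).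
  by apply: eq_bigr => w /negPf ->.
rewrite EZ_prod (bigD1 y) //= /f eqxx /= mulr1 mulr0 addr0; congr (_ * _).
rewrite -prodr_const [RHS]big_mkcond [RHS](bigD1 y) //= (negPf yW) mul1r.
apply: eq_bigr => w /negPf ->.
by case: ifP; rewrite /= ?mulr0 ?mulr1 ?add0r // addrC subrK.
Qed.

Lemma bernoulli (d : F) r : 0 <= d <= 1 -> 1 - r%:R * d <= (1 - d) ^+ r.
Proof.
move=> /andP[d0 d1]; elim: r => [|r IH]; first by rewrite mul0r subr0.
rewrite exprS; apply: le_trans (ler_wpM2l _ IH); last by lra.
have : 0 <= r%:R * d * d by rewrite !mulr_ge0.
rewrite -natr1; nra.
Qed.

Lemma coin_pow k r : (0 < k)%N -> let q := (1 - coin_rate k) ^+ r in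
  [/\ 0 <= q, q <= 1 & 1 - r%:R / k%:R <= q].
Proof.
move=> /coin_rate_bounds[d0 dk d1] q; split.
- by rewrite exprn_ge0 // subr_ge0; lra.
- by rewrite exprn_ile1 //; lra.
apply: le_trans (bernoulli _ _); last by apply/andP; split=> //; lra.
by rewrite lerD2l lerN2 ler_wpM2l.
Qed.

(** With [K] candidates for the last arrival and [a] watched vertices, [r] of them without in-edge,
    at least [K - a + r] candidates are harmless, and [q] is the chance that no dummy fires. Dummies
    thus cost no more than in-edges would: replacing [q] by [1 - r/K] still leaves [K - a] plus
    [r(a-r)/K]. If [K - a + r] is negative, [q <= 1] is enough. *)
Lemma rate_bound (K a r q : F) : 0 < K -> 0 <= r -> r <= a ->
  1 - r / K <= q -> q <= 1 -> K - a <= (K - a + r) * q.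
Proof.
move=> K0 r0 ra q1 q2; have [c0|c0] := lerP 0 (K - a + r); last by nra.
apply: le_trans (ler_wpM2l c0 q1).
have -> : (K - a + r) * (1 - r / K) = K - a + r * ((a - r) / K) by field; rewrite gt_eqF.
by rewrite lerDl mulr_ge0 // divr_ge0 ?subr_ge0 // ltW.
Qed.

End Coins.

(** * Backward analysis *)

Section Expectation.
Variables (F : realFieldType) (n m : nat).
Local Notation coins := (coins n).
Local Notation event := ('I_m * coins)%type.
Implicit Types (S : {set 'I_m}) (l : seq event) (G H : seq event -> F).

(* Lists of events are in reverse chronological order: the head arrived last. *)
Definition arrivals_of S l : Prop := uniq [seq q.1 | q <- l] /\ [seq q.1 | q <- l] =i S.

(* Expectation over a uniform ordering of S and the coins, meaningful for
   k = #|S|. *)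
Fixpoint Ex k S G : F :=
  if k is k'.+1 then
    k%:R^-1 * \sum_(x in S) EZ k (fun Z => Ex k' (S :\ x) (fun l => G ((x, Z) :: l)))
  else G [::].

Lemma arrivals_cons S l x Z : x \in S -> arrivals_of (S :\ x) l ->
  arrivals_of S ((x, Z) :: l).
Proof.
move=> xS [ul lS]; split => [|y]; rewrite /= ?lS ?ul ?inE ?eqxx //=.
by rewrite lS !inE; case: eqVneq => // ->.
Qed.

Lemma arrivals_size S l : arrivals_of S l -> size l = #|S|.
Proof.
case=> ul lS; rewrite -(size_map fst) -(card_uniqP ul).
exact: eq_card.
Qed.

Lemma Ex_le k S G H : #|S| = k ->
  (forall l, arrivals_of S l -> G l <= H l) -> Ex k S G <= Ex k S H.
Proof.
elim: k S G H => [|k IH] S G H cS GH /=.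
  by apply: GH; split => // x; rewrite (cards0_eq cS) inE.
rewrite ler_wpM2l ?invr_ge0 //; apply: ler_sum => x xS.
apply: EZ_le => // Z; apply: IH => [|l lS].
  by move: cS; rewrite (cardsD1 x) xS => -[].
exact/GH/arrivals_cons.
Qed.

Lemma EZ_add k (f g : coins -> F) : EZ k (fun Z => f Z + g Z) = EZ k f + EZ k g.
Proof. by rewrite -big_split; apply: eq_bigr => Z _; rewrite mulrDr. Qed.

Lemma EZ_scale k c (f : coins -> F) : EZ k (fun Z => c * f Z) = c * EZ k f.
Proof. by rewrite /EZ mulr_sumr; apply: eq_bigr => Z _; rewrite mulrCA. Qed.

Lemma eq_EZ k (f g : coins -> F) : f =1 g -> EZ k f = EZ k g.
Proof. by move=> fg; apply: eq_bigr => Z _; rewrite fg. Qed.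

Lemma Ex_add k S G H : Ex k S (fun l => G l + H l) = Ex k S G + Ex k S H.
Proof.
elim: k S G H => [|k IH] S G H //=.
rewrite -mulrDr -big_split; congr (_ * _); apply: eq_bigr => x _.
by rewrite /= -EZ_add; apply: eq_EZ => Z; apply: IH.
Qed.

Lemma Ex_scale k S c G : Ex k S (fun l => c * G l) = c * Ex k S G.
Proof.
elim: k S G => [|k IH] S G //=.
rewrite [RHS]mulrCA; congr (_ * _); rewrite mulr_sumr; apply: eq_bigr => x _.
by rewrite -EZ_scale; apply: eq_EZ => Z; apply: IH.
Qed.

Lemma Ex_cst k S c : #|S| = k -> Ex k S (fun=> c) = c.
Proof.
elim: k S => [|k IH] S cS //=.
rewrite (eq_bigr (fun=> c)) => [|x xS].
  by rewrite sumr_const cS -[c *+ _]mulr_natl mulKf // pnatr_eq0.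
rewrite -[RHS](@EZ_cst F n k.+1); apply: eq_EZ => Z; apply: IH.
by move: cS; rewrite (cardsD1 x) xS => -[].
Qed.

(** Condition on the last arrival [x]. Its coins are independent of the earlier arrivals, so
    products factor. The pair [g], [A] carries over what held before; [h], [B] is the extra gain of
    this step. *)
Lemma Ex_step k S G (g h : 'I_m -> coins -> F) (A B : 'I_m -> seq event -> F) :
  #|S| = k.+1 ->
  (forall x Z l, x \in S -> arrivals_of (S :\ x) l ->
     g x Z * A x l + h x Z * B x l <= G ((x, Z) :: l)) ->
  \sum_(x in S) (EZ k.+1 (g x) * Ex k (S :\ x) (A x) +
                 EZ k.+1 (h x) * Ex k (S :\ x) (B x)) <= k.+1%:R * Ex k.+1 S G.
Proof.
move=> cS H /=; rewrite mulVKf ?pnatr_eq0 //; apply: ler_sum => x xS.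
have cSx : #|S :\ x| = k by move: cS; rewrite (cardsD1 x) xS => -[].
set a := Ex k _ _; set b := Ex k _ _.
rewrite ![_ * a]mulrC ![_ * b]mulrC -!EZ_scale -EZ_add; apply: EZ_le => // Z.
rewrite [a * _]mulrC [b * _]mulrC -!Ex_scale -Ex_add; apply: Ex_le => // l lS.
exact: H.
Qed.

End Expectation.

(** * Blocking probabilities and expected value of the process *)

Section Process.
Variables (F : realFieldType) (n m : nat) (ends : 'I_m -> 'I_n * 'I_n).
Hypothesis loop : loopless ends.
Variables (T : eqType) (ed : T -> 'I_n * 'I_n) (gt : rel T) (L : 'I_m -> T) (p : nat).
Hypothesis edL : forall e, ed (L e) = ends e.
Hypothesis injL : injective L.
Hypothesis ordL : forall S, strict_order_on gt (edges L S).
Local Notation coins := (coins n).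
Local Notation event := ('I_m * coins)%type.
Implicit Types (S : {set 'I_m}) (W : {set 'I_n}) (Z : coins) (l : seq event).
Implicit Types (x y e : 'I_m) (u v w : 'I_n).

Definition mst l := foldr (fun q st => mstep ed gt p st (L q.1) q.2) ([::], set0) l.
Definition blocked l := (mst l).2.

Fixpoint accepted l : {set 'I_m} :=
  if l is q :: l' then
    if accepts ed gt p (mst l') (L q.1) then q.1 |: accepted l' else accepted l'
  else set0.

Definition intree S x := L x \in tree ed gt (edges L S).
Definition hd S x := ehead ed gt (edges L S) (L x).
Definition tl S x := etail ed gt (edges L S) (L x).
Definition hin S w := has_in ed gt (edges L S) w.

Lemma mst1 l : (mst l).1 = [seq L q.1 | q <- l].
Proof. by elim: l => //= q l ->. Qed.

Lemma size_mst l : size (mst l).1 = size l.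
Proof. by rewrite mst1 size_map. Qed.

Lemma blocked_sample l : (size l <= p)%N -> blocked l = set0.
Proof.
elim: l => [|q l IH] //= szl; apply/setP => w.
rewrite !inE /accepts size_mst leqNgt szl /= orbF.
by rewrite -/(blocked l) IH ?inE // ltnW.
Qed.

Lemma arrivals_edges S l x : x \in S -> arrivals_of (S :\ x) l ->
  L x :: (mst l).1 =i edges L S.
Proof.
move=> xS [_ lS] t; rewrite mst1 inE; apply/idP/edgesP.
  case/orP => [/eqP->|/mapP[q ql ->]]; first by exists x.
  exists q.1 => //; have : q.1 \in [seq q.1 | q <- l] by apply: map_f.
  by rewrite lS !inE => /andP[].
case=> e eS ->; have [->|ex] := eqVneq e x; first by rewrite eqxx.
have : e \in [seq q.1 | q <- l] by rewrite lS !inE ex.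
by case/mapP => q ql ->; rewrite [X in _ || X]map_f ?orbT.
Qed.

Lemma eq_has_in (R1 R2 : seq T) w : R1 =i R2 -> has_in ed gt R1 w = has_in ed gt R2 w.
Proof.
move=> R12; rewrite /has_in (eq_has (a2 := fun t => ehead ed gt R2 t == w)).
  exact/eq_has_r/eq_tree.
by move=> t; rewrite (eq_ehead ed gt R12).
Qed.

Lemma accepts_cons S l x : x \in S -> arrivals_of (S :\ x) l -> 
  accepts ed gt p (mst l) (L x) =
  [&& (p < #|S|)%N, intree S x, (ends x).1 \notin blocked l & (ends x).2 \notin blocked l].
Proof.
move=> xS lS; rewrite /accepts size_mst (arrivals_size lS) (cardsD1 x S) xS add1n ltnS.
by rewrite (eq_tree ed gt (arrivals_edges xS lS)) edL.
Qed.

Lemma blocked_cons S l x Z w : (p < #|S|)%N -> x \in S -> arrivals_of (S :\ x) l ->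
  (w \in blocked ((x, Z) :: l)) =
  [|| w \in blocked l, Z w && ~~ hin S w |
      [&& intree S x, (ends x).1 \notin blocked l & (ends x).2 \notin blocked l] &&
      (w == hd S x)].
Proof.
move=> pS xS lS; rewrite /blocked /= inE (accepts_cons xS lS) pS.
have -> : (p <= size (mst l).1)%N.
  by move: pS; rewrite size_mst (arrivals_size lS) (cardsD1 x S) xS add1n ltnS.
rewrite (eq_has_in _ (arrivals_edges xS lS)).
by rewrite (eq_ehead ed gt (arrivals_edges xS lS)).
Qed.

Lemma loopT S t : t \in edges L S -> (ed t).1 != (ed t).2.
Proof. by case/edgesP => e _ ->; rewrite edL loop. Qed.

Lemma intree_sub S x : intree S x -> x \in S.
Proof. by move/tree_sub; rewrite mem_edges. Qed.

Lemma hd_inj S x y : intree S x -> intree S y -> hd S x = hd S y -> x = y.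
Proof.
move=> xT yT hxy; apply: injL.
exact: (ehead_inj (ordL S) (@loopT S) xT yT hxy).
Qed.

Lemma tree_simpleS S x y : intree S x -> intree S y ->
  hd S x = tl S y -> tl S x = hd S y -> x = y.
Proof.
move=> xT yT h1 h2; apply: injL.
exact: (tree_simple (ordL S) (@loopT S) xT yT h1 h2).
Qed.

Lemma ends_hd_tl S x w : (w \in pred2 (ends x).1 (ends x).2) = (w == hd S x) || (w == tl S x).
Proof. by rewrite -edL -(ends_ehead_etail gt (edges L S)) // edL loop. Qed.

Lemma hd_neq_tl S x : hd S x != tl S x.
Proof.
rewrite /tl /etail -/(hd S x); have [h|] := eqVneq (hd S x) (ed (L x)).1; last by [].
by rewrite h edL loop.
Qed.

Lemma hinP S w : reflect (exists2 x, intree S x & hd S x = w) (hin S w).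
Proof.
apply: (iffP hasP) => [[t tT /eqP <-]|[x xT <-]]; last by exists (L x).
by have /edgesP[x _ tx] := tree_sub tT; exists x; rewrite /intree /hd -tx.
Qed.

Definition hits S W x := intree S x && (hd S x \in W).

(** By [hd_inj] distinct edges into [W] have distinct heads, and these differ from the vertices of
    [W] without in-edge. *)
Lemma card_hits S W :
  (#|[set x in S | hits S W x]| + #|[set w in W | ~~ hin S w]| <= #|W|)%N.
Proof.
rewrite -(card_in_imset (f := hd S)); last first.
  move=> x y; rewrite !inE => /and3P[_ xT _] /and3P[_ yT _]; exact: hd_inj.
rewrite -(cardsID [set w | hin S w] W) leq_add //.
  apply: subset_leq_card; apply/subsetP => w /imsetP[x]; rewrite !inE.
  by case/and3P => _ xT xW ->; rewrite xW /=; apply/hinP; exists x.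
by apply: subset_leq_card; apply/subsetP => w; rewrite !inE andbC.
Qed.

Definition clear W l : bool := [disjoint W & blocked l].
Definition roots S W := [set w in W | ~~ hin S w].

Lemma clear_sample W l : (size l <= p)%N -> clear W l.
Proof. by move=> szl; rewrite /clear blocked_sample // disjoint_sym disjoints_subset sub0set. Qed.

(** A vertex is newly blocked either as head of its accepted in-edge or, lacking an in-edge, by its
    coin; both are excluded on [W]. *)
Lemma clear_cons S W l x Z : (p < #|S|)%N -> x \in S -> arrivals_of (S :\ x) l ->
  ~~ hits S W x -> [forall w in roots S W, ~~ Z w] -> clear W l -> clear W ((x, Z) :: l).
Proof.
move=> pS xS lS nh nc cl; rewrite /clear disjoint_subset; apply/subsetP => w wW.
rewrite inE (blocked_cons _ _ pS xS lS) (disjointFr cl wW) /= negb_or.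
apply/andP; split.
  rewrite negb_and negbK; case: (boolP (hin S w)) => hw; rewrite ?orbT ?orbF //.
  by move/forall_inP: nc; apply; rewrite inE wW.
by apply: contra nh => /andP[/andP[xT _] /eqP wh]; rewrite /hits xT -wh.
Qed.

Lemma sum_nonhits S W (c : F) : 0 <= c ->
  (#|S|%:R - #|W|%:R + #|roots S W|%:R) * c <= \sum_(x in S) (~~ hits S W x)%:R * c.
Proof.
move=> c0; rewrite -mulr_suml ler_wpM2r // -natr_sum.
have -> : (\sum_(x in S) ~~ hits S W x)%N = #|[set x in S | ~~ hits S W x]|.
  by rewrite -sum1dep_card big_mkcondr; apply: eq_bigr => x _; case: (hits S W x).
have := card_hits S W; have := cardsID [set x | hits S W x] S.
have -> : S :&: [set x | hits S W x] = [set x in S | hits S W x].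
  by apply/setP => x; rewrite !inE.
have -> : S :\: [set x | hits S W x] = [set x in S | ~~ hits S W x].
  by apply/setP => x; rewrite !inE andbC.
rewrite -/(roots S W) => <- H; rewrite natrD.
have : (#|[set x in S | hits S W x]|%:R + #|roots S W|%:R : F) <= #|W|%:R.
  by rewrite -natrD ler_nat.
lra.
Qed.

Lemma roots_sub S W : roots S W \subset W.
Proof. by apply/subsetP => w; rewrite inE => /andP[]. Qed.

Section Sequences.
Variables (nu3 nu4 mu nn : nat -> F).

(** Abstract demands on a survival bound for [j] vertices. Keeping them apart from closed forms lets
    small and large instances share the probabilistic part. The recurrence stops at [k.+1 < m], as
    only the state before an arrival matters. *)
Definition clear_bound j (nu : nat -> F) := forall k, 
  [/\ 0 <= nu k, (k <= p)%N -> nu k <= 1 &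
      (p <= k)%N && (k.+1 < m)%N -> k.+1%:R * nu k.+1 <= (k.+1%:R - j%:R) * nu k].

(** Backward induction: [sum_nonhits] counts the last arrivals that avoid [W], [rate_bound] pays for
    the dummy coins, and the induction hypothesis treats the other [k] arrivals. *)
Lemma prob_clear j nu W k S : clear_bound j nu -> (#|W| <= j)%N -> #|S| = k -> (k < m)%N ->
  nu k <= Ex k S (fun l => (clear W l)%:R).
Proof.
move=> Hnu Wj; elim: k S => [|k IH] S cS km.
  have [_ H _] := Hnu 0%N; apply: le_trans (H (leq0n _)) _.
  by rewrite /= clear_sample.
have [kp|pk] := leqP k.+1 p.
  have [_ H _] := Hnu k.+1; apply: le_trans (H kp) _.
  rewrite -[leLHS](Ex_cst n 1 cS); apply: Ex_le => // l lS.
  by rewrite clear_sample // (arrivals_size lS) cS.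
have pS : (p < #|S|)%N by rewrite cS.
have km' := ltnW km; have pkm : (p <= k)%N && (k.+1 < m)%N by rewrite -ltnS pk.
have [n0 _ /(_ pkm) Hk] := Hnu k.
rewrite -(ler_pM2l (x := k.+1%:R)) ?ltr0Sn //.
apply: le_trans (@Ex_step F n m k S (fun l => (clear W l)%:R)
  (fun x Z => (~~ hits S W x)%:R * no_coin F (roots S W) Z) (fun _ _ => 0)
  (fun _ l => (clear W l)%:R) (fun _ _ => 0) cS _); last first.
  move=> x Z l xS lS.
  rewrite mul0r addr0; case: (boolP (hits S W x)) => hx; first by rewrite !mul0r.
  rewrite mul1r /no_coin; case: (boolP [forall _ in _, _]) => cz; last by rewrite mul0r.
  rewrite mul1r; case: (boolP (clear W l)) => cl; last by [].
  by rewrite (clear_cons pS xS lS hx cz cl).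
set q := (1 - coin_rate F k.+1) ^+ #|roots S W|.
have [d0 dk d1] := coin_rate_bounds F (ltn0Sn k).
have q0 : 0 <= q by rewrite exprn_ge0 // subr_ge0; lra.
have := sum_nonhits S W (mulr_ge0 q0 n0) => /le_trans H2.
apply: le_trans (H2 _ _) => {H2}; last first.
  apply: ler_sum => x xS; rewrite EZ_scale EZ_no_coin -/q EZ_cst mul0r addr0 -mulrA.
  rewrite ler_wpM2l // ler_wpM2l // IH //.
  by move: cS; rewrite (cardsD1 x) xS => -[].
have [_ q1 q2] := coin_pow F #|roots S W| (ltn0Sn k).
apply: le_trans Hk _; rewrite cS mulrA ler_wpM2r //.
apply: le_trans (rate_bound _ _ _ q2 q1); rewrite ?ltr0Sn ?ler0n //.
  by rewrite lerD2l lerN2 ler_nat.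
by rewrite ler_nat subset_leq_card // roots_sub.
Qed.

Hypotheses (Hnu3 : clear_bound 3 nu3) (Hnu4 : clear_bound 4 nu4).
Hypothesis Hmu : forall k, [/\ 0 <= mu k, (k <= p)%N -> mu k <= 0,
  (p <= k)%N && (k.+1 < m)%N -> k.+1%:R * mu k.+1 <=
    (k.+1%:R - 2%:R) * mu k + (1 - coin_rate F k.+1) ^+ 2 * nu4 k &
  (p <= k)%N && (k.+1 < m)%N -> k.+1%:R * mu k.+1 <=
    (k.+1%:R - 2%:R) * (mu k + coin_rate F k.+1 * nu3 k)].

Definition shield W (y : 'I_n) l : bool := clear W l && (y \in blocked l).

(** Either [y] was blocked before, and stays so, or the last step blocks it. If [y] has an in-edge,
    that edge may come last, which needs four clear vertices; otherwise the coin of [y] may fire,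
    with three clear vertices. The two recurrences for [mu] are these two cases. *)
Lemma prob_shield u v (y : 'I_n) k S : u != v -> y \notin [set u; v] -> #|S| = k -> (k < m)%N ->
  mu k <= Ex k S (fun l => (shield [set u; v] y l)%:R).
Proof.
move=> uv yU; have cU : #|[set u; v]| = 2%N by rewrite cards2 uv.
set U := [set u; v] in yU cU *.
have Ex0 k' S' (P : seq event -> bool) : #|S'| = k' -> 0 <= Ex k' S' (fun l => (P l)%:R) :> F.
  by move=> cS'; rewrite -(Ex_cst n 0 cS'); apply: Ex_le.
elim: k S => [|k IH] S cS km.
  by have [_ H _ _] := Hmu 0%N; apply: le_trans (H (leq0n _)) _; apply: Ex0.
have [kp|pk] := leqP k.+1 p.
  by have [_ H _ _] := Hmu k.+1; apply: le_trans (H kp) _; apply: Ex0.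
have pS : (p < #|S|)%N by rewrite cS.
have km' := ltnW km; have pkm : (p <= k)%N && (k.+1 < m)%N by rewrite -ltnS pk.
have [m0 _ /(_ pkm) H1 /(_ pkm) H2] := Hmu k.
have [n30 _ _] := Hnu3 k; have [n40 _ _] := Hnu4 k.
rewrite -(ler_pM2l (x := k.+1%:R)) ?ltr0Sn //.
have cSx x : x \in S -> #|S :\ x| = k by move=> xS; move: cS; rewrite (cardsD1 x) xS => -[].
have [d0 dk d1] := coin_rate_bounds F (ltn0Sn k).
have [q0 q1 q2] := coin_pow F #|roots S U| (ltn0Sn k).
set q := (1 - coin_rate F k.+1) ^+ #|roots S U| in q0 q1 q2.
have rU : (#|roots S U| <= 2)%N by rewrite -cU subset_leq_card // roots_sub.
have qc : k.+1%:R - 2%:R <= (#|S|%:R - #|U|%:R + #|roots S U|%:R) * q.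
  by rewrite cS cU; apply: rate_bound => //; rewrite ?ltr0Sn ?ler0n // ler_nat.
have stay x Z l : x \in S -> arrivals_of (S :\ x) l ->
    (~~ hits S U x)%:R * no_coin F (roots S U) Z * (shield U y l)%:R <=
    (shield U y ((x, Z) :: l))%:R.
  move=> xS lS; case: (boolP (hits S U x)) => hx; first by rewrite !mul0r.
  rewrite mul1r /no_coin; case: (boolP [forall _ in _, _]) => cz; last by rewrite mul0r.
  rewrite mul1r /shield; case: (boolP (clear U l)) => cl; last by [].
  rewrite (clear_cons pS xS lS hx cz cl) (blocked_cons _ _ pS xS lS).
  by case: (y \in blocked l).
have [/hinP[x0 x0T x0y]|nhy] := boolP (hin S y).
  have x0S := intree_sub x0T.
  (* With both endpoints clear, [x0] is accepted and blocks [y]. Its tail may lie in the pair, so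
     [W] has at most four elements. *)
  pose W := [set u; v; y; tl S x0].
  have hx0 : ~~ hits S U x0 by rewrite /hits x0y (negPf yU) andbF.
  apply: le_trans (@Ex_step F n m k S _
    (fun x Z => (~~ hits S U x)%:R * no_coin F (roots S U) Z)
    (fun x Z => (x == x0)%:R * no_coin F (roots S U) Z)
    (fun _ l => (shield U y l)%:R) (fun _ l => (clear W l)%:R) cS _); last first.
    move=> x Z l xS lS; have [xx0|xx0] := eqVneq x x0; last first.
      by rewrite !mul0r addr0 stay.
    rewrite mul1r xx0 in xS lS *.
    have UW : U \subset W.
      by apply/subsetP => w; rewrite !inE => /orP[] ->; rewrite ?orbT.
    have [cW|cW] := boolP (clear W l); last first.
      by rewrite mulr0 addr0; apply: stay.
    have yb : y \notin blocked l by rewrite (disjointFr cW) // !inE eqxx orbT.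
    rewrite /shield (negPf yb) andbF mulr0 add0r mulr1 /no_coin.
    case: (boolP [forall _ in _, _]) => cz; last by [].
    have cU' : clear U l by apply: disjointWl UW cW.
    rewrite (clear_cons pS xS lS hx0 cz cU') (blocked_cons _ _ pS xS lS) x0T x0y eqxx.
    have ne w : w \in pred2 (ends x0).1 (ends x0).2 -> w \notin blocked l.
      rewrite (ends_hd_tl S) x0y => ww; rewrite (disjointFr cW) // !inE.
      by case/orP: ww => /eqP ->; rewrite eqxx ?orbT.
    by rewrite !ne ?orbT // !inE eqxx ?orbT.
  apply: le_trans H1 _; rewrite big_split /=; apply: lerD.
    apply: le_trans (ler_wpM2r m0 qc) _; rewrite -mulrA.
    apply: le_trans (sum_nonhits S U (mulr_ge0 q0 m0)) _.
    apply: ler_sum => x xS; rewrite EZ_scale EZ_no_coin -/q -mulrA.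
    by rewrite ler_wpM2l // ler_wpM2l // IH // cSx.
  rewrite (bigD1 x0) //= eqxx big1 => [|x /andP[_ /negPf xx0]]; last first.
    by rewrite xx0 EZ_scale !mul0r.
  rewrite addr0 EZ_scale EZ_no_coin mul1r; apply: ler_pM => //.
  - by rewrite exprn_ge0 // subr_ge0; lra.
  - rewrite -/q /q; apply: ler_wiXn2l => //; lra.
  - apply: (prob_clear Hnu4 _ (cSx _ x0S) km').
    rewrite /W; apply: leq_trans (leq_card_setU _ _) _; rewrite cards1 addn1 ltnS.
    by apply: leq_trans (leq_card_setU _ _) _; rewrite cards1 addn1 -/U cU.
pose W := [set u; v; y].
apply: le_trans (@Ex_step F n m k S _
    (fun x Z => (~~ hits S U x)%:R * no_coin F (roots S U) Z)
    (fun x Z => (~~ hits S U x)%:R * ((Z y)%:R * no_coin F (roots S U) Z))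
    (fun _ l => (shield U y l)%:R) (fun _ l => (clear W l)%:R) cS _); last first.
  move=> x Z l xS lS; have [cW|cW] := boolP (clear W l); last first.
    by rewrite [X in _ + X]mulr0 addr0 stay.
  have yb : y \notin blocked l by rewrite (disjointFr cW) // !inE eqxx orbT.
  rewrite /shield (negPf yb) andbF mulr0 add0r mulr1.
  case: (boolP (hits S U x)) => hx; first by rewrite !mul0r.
  rewrite mul1r; case: (boolP (Z y)) => zy; last by rewrite mul0r.
  rewrite mul1r /no_coin; case: (boolP [forall _ in _, _]) => cz; last by [].
  have UW : U \subset W.
    by apply/subsetP => w; rewrite !inE => /orP[] ->; rewrite ?orbT.
  rewrite (clear_cons pS xS lS hx cz (disjointWl UW cW)) (blocked_cons _ _ pS xS lS).
  by rewrite zy nhy orbT.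
apply: le_trans H2 _.
set c := mu k + _; have c0 : 0 <= c by rewrite addr_ge0 // mulr_ge0.
apply: le_trans (ler_wpM2r c0 qc) _; rewrite -mulrA.
apply: le_trans (sum_nonhits S U (mulr_ge0 q0 c0)) _.
apply: ler_sum => x xS; rewrite !EZ_scale EZ_no_coin EZ_one_coin; last first.
  by rewrite inE (negPf yU).
rewrite -/q -![_%:R * _ * _]mulrA -mulrDr ler_wpM2l // /c mulrDr lerD //.
  by rewrite ler_wpM2l // IH // cSx.
rewrite [coin_rate F _ * q]mulrC -mulrA ler_wpM2l // ler_wpM2l //.
apply: (prob_clear Hnu3 _ (cSx _ xS) km').
by apply: leq_trans (leq_card_setU _ _) _; rewrite cards1 addn1 -/U cU.
Qed.

Hypothesis Hnn : forall k, [/\ 0 <= nn k, (k <= p)%N -> nn k <= 1,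
  (p <= k)%N && (k.+1 < m)%N -> k.+1%:R * nn k.+1 <= (k.+1%:R - 2%:R) * nn k + mu k &
  (p <= k)%N && (k.+1 < m)%N -> k.+1%:R * nn k.+1 <= (k.+1%:R - 1) * (1 - coin_rate F k.+1) * nn k].

(* Distinct tree edges are not parallel, so one of the two in-edges of u and v
   comes from outside {u, v}. *)
Lemma outer_in_edge S u v : u != v -> hin S u -> hin S v ->
  exists x, [/\ intree S x, hd S x \in [set u; v] & tl S x \notin [set u; v]].
Proof.
move=> uv /hinP[x xT xu] /hinP[y yT yv].
have [tx|tx] := boolP (tl S x \in [set u; v]); last first.
  by exists x; split=> //; rewrite xu !inE eqxx.
exists y; split=> //; first by rewrite yv !inE eqxx orbT.
rewrite !inE.
have txv : tl S x = v.
  move: tx (hd_neq_tl S x); rewrite !inE xu => /orP[/eqP->|/eqP//].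
  by rewrite eqxx.
have := hd_neq_tl S y; rewrite yv [v == _]eq_sym => /negPf ->; rewrite orbF.
apply/eqP => tyu; have xy := tree_simpleS xT yT.
move: uv; rewrite -xu -yv xy ?eqxx //; first by rewrite xu tyu.
by rewrite txv yv.
Qed.

(** If both vertices have in-edges, the edge [x0] of [outer_in_edge] would hit the pair but is
    rejected when its tail is blocked; [prob_shield] turns this into the term [mu k]. If one has
    none, only its coin threatens it, at half the rate of an in-edge, which is the second
    recurrence. *)
Lemma prob_pair u v k S : u != v -> #|S| = k -> (k < m)%N ->
  nn k <= Ex k S (fun l => (clear [set u; v] l)%:R).
Proof.
move=> uv; have cU : #|[set u; v]| = 2%N by rewrite cards2 uv.
set U := [set u; v] in cU *.
elim: k S => [|k IH] S cS km.
  have [_ H _ _] := Hnn 0%N; apply: le_trans (H (leq0n _)) _.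
  by rewrite /= clear_sample.
have [kp|pk] := leqP k.+1 p.
  have [_ H _ _] := Hnn k.+1; apply: le_trans (H kp) _.
  rewrite -[leLHS](Ex_cst n 1 cS); apply: Ex_le => // l lS.
  by rewrite clear_sample // (arrivals_size lS) cS.
have pS : (p < #|S|)%N by rewrite cS.
have km' := ltnW km; have pkm : (p <= k)%N && (k.+1 < m)%N by rewrite -ltnS pk.
have [n0 _ /(_ pkm) H1 /(_ pkm) H2] := Hnn k.
have [m0 _ _ _] := Hmu k.
rewrite -(ler_pM2l (x := k.+1%:R)) ?ltr0Sn //.
have cSx x : x \in S -> #|S :\ x| = k by move=> xS; move: cS; rewrite (cardsD1 x) xS => -[].
have [d0 dk d1] := coin_rate_bounds F (ltn0Sn k).
have [q0 q1 q2] := coin_pow F #|roots S U| (ltn0Sn k).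
set q := (1 - coin_rate F k.+1) ^+ #|roots S U| in q0 q1 q2.
have stay x Z l : x \in S -> arrivals_of (S :\ x) l ->
    (~~ hits S U x)%:R * no_coin F (roots S U) Z * (clear U l)%:R <=
    (clear U ((x, Z) :: l))%:R.
  move=> xS lS; case: (boolP (hits S U x)) => hx; first by rewrite !mul0r.
  rewrite mul1r /no_coin; case: (boolP [forall _ in _, _]) => cz; last by rewrite mul0r.
  rewrite mul1r; case: (boolP (clear U l)) => cl; last by [].
  by rewrite (clear_cons pS xS lS hx cz cl).
have main : (#|S|%:R - #|U|%:R + #|roots S U|%:R) * (q * nn k) <=
    \sum_(x in S) EZ k.+1 (fun Z => (~~ hits S U x)%:R * no_coin F (roots S U) Z) *
      Ex k (S :\ x) (fun l => (clear U l)%:R).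
  apply: le_trans (sum_nonhits S U (mulr_ge0 q0 n0)) _.
  apply: ler_sum => x xS; rewrite EZ_scale EZ_no_coin -/q -mulrA.
  by rewrite ler_wpM2l // ler_wpM2l // IH // cSx.
have [/andP[hu hv]|nh] := boolP (hin S u && hin S v).
  have [x0 [x0T x0U x0t]] := outer_in_edge uv hu hv.
  have x0S := intree_sub x0T.
  have r0 : #|roots S U| = 0%N.
    apply/eqP; rewrite cards_eq0; apply/eqP/setP => w; rewrite !inE.
    by apply/negbTE; rewrite negb_and negbK; case: eqP => [->|_]; [rewrite hu|
       case: eqP => [->|//]; rewrite hv].
  apply: le_trans (@Ex_step F n m k S _
    (fun x Z => (~~ hits S U x)%:R * no_coin F (roots S U) Z)
    (fun x Z => (x == x0)%:R)
    (fun _ l => (clear U l)%:R) (fun _ l => (shield U (tl S x0) l)%:R) cS _); last first.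
    move=> x Z l xS lS; have [xx0|xx0] := eqVneq x x0; last first.
      by rewrite mul0r addr0 stay.
    have hx : hits S U x by rewrite xx0 /hits x0T.
    rewrite hx !mul0r add0r mul1r /shield.
    case: (boolP (clear U l)) => cl; last by [].
    case: (boolP (_ \in blocked l)) => bl; last by [].
    rewrite /clear disjoint_subset (_ : U \subset _) //; apply/subsetP => w wU.
    have rw : w \notin roots S U.
      by rewrite (eqP (_ : roots S U == set0)) ?inE // -cards_eq0 r0.
    rewrite inE (blocked_cons _ _ pS xS lS) (disjointFr cl wU) /=.
    rewrite inE wU negbK in rw; rewrite rw andbF /=.
    have : tl S x0 \in pred2 (ends x).1 (ends x).2 by rewrite (ends_hd_tl S) xx0 eqxx orbT.
    by rewrite inE => /orP[] /eqP <-; rewrite bl ?andbF.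
  apply: le_trans H1 _; rewrite big_split /=; apply: lerD.
    by apply: le_trans main; rewrite cS cU r0 /q r0 expr0 mul1r addr0.
  rewrite (bigD1 x0) //= eqxx big1 => [|x /andP[_ /negPf xx0]]; last first.
    by rewrite xx0 EZ_cst mul0r.
  by rewrite addr0 EZ_cst mul1r; apply: prob_shield; rewrite ?cSx.
apply: le_trans (@Ex_step F n m k S _
    (fun x Z => (~~ hits S U x)%:R * no_coin F (roots S U) Z) (fun _ _ => 0)
    (fun _ l => (clear U l)%:R) (fun _ _ => 0) cS _); last first.
  by move=> x Z l xS lS; rewrite mul0r addr0 stay.
rewrite big_split /= [X in _ + X]big1 ?addr0 => [|x _]; last by rewrite EZ_cst mul0r.
apply: le_trans main; apply: le_trans H2 _; rewrite mulrA ler_wpM2r //.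
have rU : (#|roots S U| <= 2)%N by rewrite -cU subset_leq_card // roots_sub.
have r1 : (0 < #|roots S U|)%N.
  rewrite card_gt0; apply: contra nh => /eqP r0.
  have nr w : w \in U -> hin S w.
    by move=> wU; apply: contraT => hw; rewrite -(in_set0 w) -r0 inE wU.
  by rewrite !nr // !inE eqxx ?orbT.
rewrite cS cU /q; move: rU r1; case: #|roots S U| => [|[|[|]]] // _ _.
  by rewrite expr1 ler_wpM2r ?subr_ge0 //; lra.
(* With two roots no arrival hits the pair; one factor [1 - coin_rate] is at least [k / (k+1)],
   which brings back the bound for one root. *)
rewrite subrK expr2 mulrA ler_wpM2r ?subr_ge0 //; first by lra.
rewrite mulrBr mulr1 lerD2l lerN2.
by rewrite -ler_pdivlMl ?ltr0Sn // mulr1.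
Qed.

Lemma accepted_sub S l : arrivals_of S l -> accepted l \subset S.
Proof.
case=> _ lS; have sub : {subset accepted l <= [seq q.1 | q <- l]}.
  elim: l {lS} => [|q l IH] x /=; first by rewrite inE.
  case: ifP => _; last by move=> /IH; rewrite inE => ->; rewrite orbT.
  by rewrite !inE => /orP[->//|/IH->]; rewrite orbT.
by apply/subsetP => x /sub; rewrite lS.
Qed.

(** An edge of the optimal forest is equally likely to be at each position, and with [i >= p]
    arrivals before it, it is accepted with probability at least [nn i]. The induction over the last
    arrival [x] splits the weight into that of [x] and the rest. *)
Lemma expected_value (w : 'I_m -> F) k S : (forall x, 0 <= w x) -> #|S| = k ->
  k%:R^-1 * (\sum_(p <= i < k) nn i) * \sum_(x in S | intree setT x) w x <=
  Ex k S (fun l => \sum_(x in accepted l) w x).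
Proof.
move=> w0; elim: k S => [|k IH] S cS.
  by rewrite invr0 !mul0r /= big_set0.
rewrite -(ler_pM2l (x := k.+1%:R)) ?ltr0Sn //.
have cSx x : x \in S -> #|S :\ x| = k by move=> xS; move: cS; rewrite (cardsD1 x) xS => -[].
set W := \sum_(x in S | _) w x.
apply: le_trans (@Ex_step F n m k S _
    (fun x Z => 1) (fun x Z => ((p <= k)%N && intree setT x)%:R * w x)
    (fun _ l => \sum_(x in accepted l) w x)
    (fun x l => (clear [set (ends x).1; (ends x).2] l)%:R) cS _); last first.
  move=> x Z l xS lS; rewrite mul1r [accepted ((x, Z) :: l)]/=.
  rewrite (accepts_cons xS lS) cS ltnS.
  have xA : x \notin accepted l.
    by apply/negP => /(subsetP (accepted_sub lS)); rewrite !inE eqxx.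
  have [pk|kp] /= := leqP p k; last by rewrite !mul0r addr0.
  case: (boolP (intree setT x)) => xT; last first.
    rewrite !mul0r addr0; case: ifP => _ //.
    by rewrite big_setU1 //= lerDr.
  rewrite mul1r; case: (boolP (clear _ l)) => cl; last first.
    rewrite mulr0 addr0; case: ifP => _ //.
    by rewrite big_setU1 //= lerDr.
  have -> : intree S x.
    move: xT; rewrite /intree !mem_tree; apply: in_tree_sub; last by rewrite mem_edges.
    by move=> t /edgesP[e eS ->]; rewrite mem_edges // inE.
  rewrite !(disjointFr cl) ?inE ?eqxx ?orbT //=.
  by rewrite big_setU1 //= mulr1 addrC.
have split_sum x : x \in S -> \sum_(y in S :\ x | intree setT y) w y =
    W - (intree setT x)%:R * w x.
  move=> xS; apply/eqP; rewrite eq_sym subr_eq /W big_mkcondr (bigD1 x) //= addrC.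
  rewrite [X in _ == X + _]big_mkcondr; apply/eqP; congr (_ + _).
    by apply: eq_bigl => i; rewrite !inE andbC.
  by case: ifP; rewrite ?mul1r ?mul0r.
have sumW : \sum_(x in S) (intree setT x)%:R * w x = W.
  by rewrite /W [RHS]big_mkcondr; apply: eq_bigr => x _; case: ifP; rewrite ?mul1r ?mul0r.
set C := \sum_(p <= i < k) nn i in IH *.
(* Spread the target over the choices of the last arrival: each optimal edge of [S] is missing from
   [S :\ x] for exactly one [x]. *)
have -> : k.+1%:R * (k.+1%:R^-1 * (\sum_(p <= i < k.+1) nn i) * W) =
    \sum_(x in S) (k%:R^-1 * C * (W - (intree setT x)%:R * w x) +
      ((p <= k)%N%:R * nn k) * ((intree setT x)%:R * w x)).
  rewrite big_split /= -!mulr_sumr sumrB sumW sumr_const cS.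
  rewrite -[X in _ * X = _]mulrA mulVKf ?pnatr_eq0 // -[W *+ _]mulr_natl.
  rewrite -[k.+1]addn1 natrD mulrDl mul1r addrK.
  have -> : k%:R^-1 * C * (k%:R * W) = C * W.
    (* For [k = 0] the inverse is 0 by convention, and [C] is an empty sum. *)
    case: k @C {IH cS cSx} => [|k] C; first by rewrite /C big_geq // mulr0 !mul0r.
    by rewrite mulrACA mulrA mulVf ?pnatr_eq0 // mul1r.
  have [pk|kp] := leqP p k; first by rewrite addn1 big_nat_recr //= mul1r mulrDl.
  by rewrite !mul0r addr0 /C !big_geq ?addn1 // ltnW.
apply: ler_sum => x xS; apply: lerD.
  by rewrite EZ_cst mul1r -split_sum // IH // cSx.
rewrite EZ_cst; case: (p <= k)%N; last by rewrite !mul0r.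
case: (intree setT x); rewrite ?mul0r ?mulr0 ?mul0r // !mul1r mulrC ler_wpM2l //.
have km : (k < m)%N by rewrite -cS -[m in (_ <= m)%N]card_ord max_card.
exact: prob_pair (loop x) (cSx _ xS) km.
Qed.

End Sequences.

(** The map [h] records the head an edge had when it was accepted; later orientations may differ.
    That head stays blocked, so a later accepted edge avoids it and [acyclic_add] applies. *)
Lemma accepted_safe l : exists h : 'I_m -> 'I_n,
  [/\ acyclic ends (accepted l), {in accepted l &, injective h},
      forall f, f \in accepted l -> h f \in pred2 (ends f).1 (ends f).2 &
      forall f, f \in accepted l -> h f \in blocked l].
Proof.
elim: l => [|[x Z] l [h [acy hinj hends hbl]]].
  exists (fun e => (ends e).1); split=> [es vs|||] => [|x y|x|x]; try by rewrite inE.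
  apply/negP => /and5P[/eqP sz szv _ _ /andP[/allP sub _]].
  case: es sz sub => [|e es] sz sub; first by rewrite -sz in szv.
  by have := sub e; rewrite mem_head inE => /(_ isT).
have mono v : v \in blocked l -> v \in blocked ((x, Z) :: l).
  by rewrite {2}/blocked /= inE => ->.
rewrite [accepted _]/=; case: (boolP (accepts _ _ _ _ _)) => [ac|_]; last first.
  by exists h; split=> // f fA; apply/mono/hbl.
set v := ehead ed gt (L x :: (mst l).1) (L x).
have vx : v \in pred2 (ends x).1 (ends x).2 by rewrite -edL ehead_ends.
have free f : f \in accepted l -> h f \notin pred2 (ends x).1 (ends x).2.
  move=> /hbl; case/and4P: ac => _ _ n1 n2; rewrite edL in n1 n2; rewrite !inE.
  by apply: contraTN => /orP[] /eqP ->.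
have nx f : f \in accepted l -> f != x.
  by move=> fA; apply: contraTneq (hends f fA) => fx; have := free _ fA; rewrite fx.
exists (fun f => if f == x then v else h f); split.
- exact: (acyclic_add loop acy hinj hends free).
- move=> f g; rewrite !inE; have [->|fx] := eqVneq f x; have [->|gx] := eqVneq g x => //=.
  + by move=> _ gA vh; have := free _ gA; rewrite -vh vx.
  + by move=> fA _ vh; have := free _ fA; rewrite vh vx.
  + exact: hinj.
- by move=> f; rewrite !inE; have [->|fx] := eqVneq f x => //= /hends.
- move=> f; rewrite inE; have [->|fx] := eqVneq f x => /=; last by rewrite inE (negPf fx) => /hbl/mono.
  by move=> _; rewrite /blocked /= inE ac eqxx !orbT.
Qed.

End Process.

(** * The recursive expectation as a sum over arrival orders *)

Section Orders.
Variables (F : realFieldType) (n m : nat).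
Local Notation coins := (coins n).
Local Notation event := ('I_m * coins)%type.
Implicit Types (S : {set 'I_m}) (l s : seq event) (G : seq event -> F) (q : event).

Fixpoint weight l : F :=
  if l is q :: l' then coin_weight F (size l').+1 q.2 * weight l' else 1.

Lemma weight_rev q0 s :
  weight (rev s) = \prod_(0 <= i < size s) coin_weight F i.+1 (nth q0 s i).2.
Proof.
elim/last_ind: s => [|s q IH]; first by rewrite big_nil.
rewrite rev_rcons /= size_rev IH size_rcons big_nat_recr //= mulrC nth_rcons ltnn eqxx.
by congr (_ * _); apply: eq_big_nat => i /andP[_ si]; rewrite nth_rcons si.
Qed.

Lemma sum_tuple_cons k (P : pred (seq event)) (f : seq event -> F) :
  \sum_(t : k.+1.-tuple event | P t) f t =
  \sum_(q : event) \sum_(t : k.-tuple event | P (q :: t)) f (q :: t).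
Proof.
rewrite pair_big_dep /= (reindex (fun u : event * k.-tuple event => cons_tuple u.1 u.2)) //=.
exists (fun t => (thead t, behead_tuple t)) => [[q t] _|t _] /=.
  by congr (_, _); apply: val_inj.
by rewrite [RHS]tuple_eta; apply: val_inj.
Qed.

Definition ordering S l := uniq [seq q.1 | q <- l] && all (fun q => q.1 \in S) l.

Lemma all_setD1 S x l :
  all (fun q => q.1 \in S :\ x) l = (x \notin [seq q.1 | q <- l]) && all (fun q => q.1 \in S) l.
Proof.
elim: l => //= q l ->; rewrite !inE negb_or [x == _]eq_sym.
by case: (q.1 == x); case: (q.1 \in S); rewrite //= andbF.
Qed.

Lemma Ex_tuples k S G :
  k`!%:R * Ex k S G = \sum_(t : k.-tuple event | ordering S t) weight t * G t.
Proof.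
elim: k S G => [|k IH] S G.
  rewrite mul1r (big_pred1 [tuple]) /= ?mul1r // => t.
  by rewrite (tuple0 t); apply/esym/eqP.
rewrite (@sum_tuple_cons k (ordering S) (fun t => weight t * G t)) factS natrM [X in X * _]mulrC /=.
rewrite -mulrA mulVKf ?pnatr_eq0 //.
transitivity (\sum_x \sum_Z \sum_(t : k.-tuple event | ordering S ((x, Z) :: t))
   weight ((x, Z) :: t) * G ((x, Z) :: t)); last first.
  by rewrite pair_bigA; apply: eq_bigr => -[x Z] _.
rewrite mulr_sumr [RHS](bigID (fun x => x \in S)) /= [X in _ = _ + X]big1 ?addr0; last first.
  move=> x xS; apply: big1 => Z _; apply: big_pred0 => t.
  by rewrite /ordering /= (negPf xS) andbF.
apply: eq_bigr => x xS; rewrite mulr_sumr; apply: eq_bigr => Z _.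
rewrite mulrCA IH mulr_sumr; apply: eq_big => [t|t _].
  by rewrite /ordering /= xS all_setD1 /= -andbA andbCA.
by rewrite /= size_tuple -mulrA.
Qed.

Definition sequence (sigma : {perm 'I_m}) (z : {ffun 'I_m -> coins}) : seq event :=
  [seq (sigma i, z i) | i <- enum 'I_m].

(** Arrival orders with coin vectors correspond to [m]-tuples of events with distinct edges, read
    backwards. *)
Lemma Ex_orders G :
  \sum_(sigma : {perm 'I_m}) \sum_(z : {ffun 'I_m -> coins})
    (\prod_(i < m) coin_weight F i.+1 (z i)) * G (rev (sequence sigma z)) =
  m`!%:R * Ex m setT G.
Proof.
rewrite Ex_tuples pair_bigA /=.
pose h (u : {perm 'I_m} * {ffun 'I_m -> coins}) : m.-tuple event :=
  [tuple of rev [tuple (u.1 i, u.2 i) | i < m]].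
(* This inverts [h]. On orderings the edges are distinct, so the default permutation of [insubd] is
   never taken there. *)
pose c (t : m.-tuple event) := (insubd (1%g : {perm 'I_m}) [ffun i => (tnth [tuple of rev t] i).1],
  [ffun i => (tnth [tuple of rev t] i).2]).
rewrite (reindex_onto h c) => [|t /andP[ut _]]; last first.
  set r := [tuple of rev t]; pose f := [ffun i => (tnth r i).1].
  have injf : injectiveb f.
    apply/injectiveP => i j; rewrite !ffunE => eij.
    have ur : uniq (map_tuple fst r) by rewrite /= map_rev rev_uniq.
    by apply: (tuple_uniqP _ ur); rewrite !tnth_map.
  have cE i : (insubd (1%g : {perm 'I_m}) f) i = (tnth r i).1.
    by rewrite -pvalE -[pval _]/(val _) insubdK // ffunE.
  have rE : [tuple ((c t).1 i, (c t).2 i) | i < m] = r.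
    by apply: eq_from_tnth => i; rewrite tnth_mktuple /= cE ffunE -surjective_pairing.
  by apply: val_inj; rewrite [LHS]/= -/(val _) -[X in rev X]/(val [tuple ((c t).1 i, (c t).2 i) | i < m]) rE /= revK.
have hE u : val (h u) = rev (sequence u.1 u.2) by rewrite /=.
apply: eq_big => [u|u _].
  apply/esym; apply/(@idP (_ && _))/andP; split.
    rewrite /ordering hE map_rev rev_uniq /sequence -map_comp.
    rewrite (map_inj_uniq (f := fst \o _)) ?enum_uniq //; last exact: perm_inj.
    by apply/allP => q _; rewrite inE.
  have rE : [tuple of rev (h u)] = [tuple (u.1 i, u.2 i) | i < m].
    by apply: val_inj; rewrite /= revK.
  rewrite /c rE; case: u {rE} => s z /=; apply/eqP; congr (_, _).
    rewrite -[RHS](valKd (1%g : {perm 'I_m})); congr (insubd _ _).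
    by apply/ffunP => i; rewrite ffunE tnth_mktuple -[val s i]/(pval s i) pvalE.
  by apply/ffunP => i; rewrite ffunE tnth_mktuple.
rewrite hE; congr (_ * _).
have sz : size (sequence u.1 u.2) = m by rewrite size_map size_enum_ord.
case E : (sequence u.1 u.2) => [|q0 l].
  by rewrite big1 // => i; have := ltn_ord i; rewrite -{2}sz E.
rewrite -E (weight_rev q0) sz big_mkord; apply: eq_bigr => i _.
by rewrite (nth_map i) ?size_enum_ord // nth_ord_enum.
Qed.
End Orders.

(** * Numerical bounds *)

Section Numerics.
Variable F : realFieldType.

(* n0 bounds the probability that two given vertices survive steps p+1, ..., k
   when rejected in-edges are not taken into account. *)
Definition n0 (p k : nat) : F :=
  if (k <= p)%N then 1 else p%:R * (p%:R - 1) / (k%:R * (k%:R - 1)).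

Lemma n0_ge0 p k : 0 <= n0 p k.
Proof.
rewrite /n0; case: leqP => // pk.
have k1 : (1 : F) <= k%:R by rewrite ler1n; lia.
apply: divr_ge0; last by rewrite mulr_ge0 // subr_ge0.
by case: p pk => [|p] _; rewrite ?mul0r // mulr_ge0 // subr_ge0 ler1n.
Qed.

Lemma n0_rec p k : (p <= k)%N -> (1 < k)%N -> k.+1%:R * n0 p k.+1 = (k.+1%:R - 2%:R) * n0 p k.
Proof.
move=> pk k1; rewrite /n0 leqNgt ltnS pk /= -[k.+1]addn1 natrD.
have x1 : (1 : F) < k%:R by rewrite ltr1n.
case: leqP => kp; last by field; rewrite !gt_eqF //; lra.
have -> : p = k by apply/eqP; rewrite eqn_leq pk.
by field; rewrite !gt_eqF //; lra.
Qed.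

Lemma n0_le p k : (p <= k)%N -> (0 < k)%N ->
  k.+1%:R * n0 p k.+1 <= (k.+1%:R - 2%:R) * n0 p k.
Proof.
case: k => [|[|k]] // pk _; last by rewrite n0_rec.
rewrite subrr mul0r /n0 ltnNge pk /=.
by case: p pk => [|[|p]] //; rewrite ?subrr ?mulr0 ?mul0r ?mulr0.
Qed.

(** Telescoping: [1/(i(i-1)) = 1/(i-1) - 1/i]. *)
Lemma sum_n0 p k : (0 < p)%N -> (p < k)%N ->
  \sum_(p <= i < k) n0 p i = p%:R * (k%:R - p%:R) / (k%:R - 1).
Proof.
move=> p0; elim: k => // k IH; rewrite ltnS leq_eqVlt => /orP[/eqP<-|pk].
  rewrite big_nat1 /n0 leqnn -[p.+1]addn1 natrD.
  have : (0 : F) < p%:R by rewrite ltr0n.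
  by move=> x0; field; rewrite addrK gt_eqF.
rewrite big_nat_recr ?(ltnW pk) //= IH // /n0 leqNgt pk /= -[k.+1]addn1 natrD.
have x1 : (1 : F) < k%:R by rewrite ltr1n; lia.
by field; rewrite !gt_eqF //; lra.
Qed.

(** The plain bound [n0] gives slightly more than [m/4]. For [m = 2p+1] the claim reads
    [79(p+1) >= 40(2p+1)], that is [p <= 39]; for even [m] it holds up to [p = 40]. *)
Lemma small_case m : (0 < m)%N -> (m./2 <= 39)%N ->
  100%:R / 395%:R * m%:R <= \sum_(m./2 <= i < m) n0 m./2 i.
Proof.
move=> m0 m39; have [p0|p0] := posnP m./2.
  have -> : m = 1%N by lia.
  by rewrite big_nat1 /n0 /=; lra.
rewrite sum_n0 //; last by lia.
have := odd_double_half m; set p := m./2 in p0 m39 *; rewrite -muln2.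
have P1 : (1 : F) <= p%:R by rewrite ler1n.
have P39 : (p%:R : F) <= 39%:R by rewrite ler_nat.
case: (odd m) => /= <-; rewrite ?add0n ?natrD natrM.
  have -> : p%:R * (1%:R + p%:R * 2%:R - p%:R) / (1%:R + p%:R * 2%:R - 1) = (p%:R + 1) / 2%:R :> F.
    by field; rewrite gt_eqF; lra.
  lra.
rewrite ler_pdivlMr; last by lra.
nra.
Qed.

(** Meets the demands on [nn] with [mu = 0], that is, with shielding ignored. The last one follows
    from [(k+1) coin_rate <= 1]. *)
Lemma small_pair_bound m k : let p := m./2 in
  [/\ 0 <= n0 p k, (k <= p)%N -> n0 p k <= 1,
  (p <= k)%N && (k.+1 < m)%N ->
    k.+1%:R * n0 p k.+1 <= (k.+1%:R - 2%:R) * n0 p k + 0 &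
  (p <= k)%N && (k.+1 < m)%N ->
    k.+1%:R * n0 p k.+1 <= (k.+1%:R - 1) * (1 - coin_rate F k.+1) * n0 p k].
Proof.
move=> p; have le : (p <= k)%N && (k.+1 < m)%N ->
    k.+1%:R * n0 p k.+1 <= (k.+1%:R - 2%:R) * n0 p k.
  by case/andP => pk' km; apply: n0_le => //; rewrite /p in pk'; lia.
split; first exact: n0_ge0.
- by rewrite /n0 => ->.
- by rewrite addr0; apply: le.
move=> /le H; apply: le_trans H _; rewrite ler_wpM2r ?n0_ge0 //.
have [d0 dk d1] := coin_rate_bounds F (ltn0Sn k).
have k1 : (1 : F) <= k.+1%:R by rewrite ler1n.
have : k.+1%:R * coin_rate F k.+1 <= 1 by rewrite -ler_pdivlMl ?mulr1 //; lra.
nra.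
Qed.

(** From [k = p] on, this quotient of falling factorials and the next one solve the recurrences of
    [clear_bound] for three and four vertices with equality, for large [p]. *)
Definition falling3 (p k : nat) : F := if (k <= p)%N then 1 else
  p%:R * (p%:R - 1) * (p%:R - 2%:R) / (k%:R * (k%:R - 1) * (k%:R - 2%:R)).
Definition falling4 (p k : nat) : F := if (k <= p)%N then 1 else
  p%:R * (p%:R - 1) * (p%:R - 2%:R) * (p%:R - 3%:R) /
  (k%:R * (k%:R - 1) * (k%:R - 2%:R) * (k%:R - 3%:R)).
(* n0 * gain bounds the probability that a third given vertex is blocked as well,
   and n0 * growth is the resulting improvement of n0. *)
Definition gain (p k : nat) : F :=
  if (k <= p)%N then 0 else (p%:R - 2%:R) * (k%:R - p%:R) / (2%:R * p%:R * k%:R).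
Definition growth (p k : nat) : F := 1 + \sum_(p <= i < k) gain p i / (i%:R - 1).

Lemma formula_at (p k : nat) (f : F -> F) : f p%:R = 1 ->
  (p <= k)%N -> (if (k <= p)%N then 1 else f k%:R) = f k%:R.
Proof.
move=> fp pk; case: leqP => // kp.
by have -> : k = p; [apply/eqP; rewrite eqn_leq kp | rewrite fp].
Qed.

(** * Closed forms for at least 40 sampled edges *)

Section Large.
Variables (m p : nat).
Hypotheses (p40 : (40 <= p)%N) (mp : (m <= 2 * p + 1)%N).

Let P40 : (40%:R : F) <= p%:R. Proof. by rewrite ler_nat. Qed.

Lemma n0E k : (p <= k)%N -> n0 p k = p%:R * (p%:R - 1) / (k%:R * (k%:R - 1)).
Proof.
move=> pk; rewrite /n0 (@formula_at p k (fun x => p%:R * (p%:R - 1) / (x * (x - 1)))) //.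
by have := P40 => ?; rewrite divff // mulf_neq0 // gt_eqF //; lra.
Qed.

Lemma falling3E k : (p <= k)%N -> falling3 p k =
  p%:R * (p%:R - 1) * (p%:R - 2%:R) / (k%:R * (k%:R - 1) * (k%:R - 2%:R)).
Proof.
move=> pk; rewrite /falling3 (@formula_at p k (fun x => p%:R * (p%:R - 1) * (p%:R - 2%:R) / (x * (x - 1) * (x - 2%:R)))) //.
by have := P40 => ?; rewrite divff // !mulf_neq0 // gt_eqF //; lra.
Qed.

Lemma falling4E k : (p <= k)%N -> falling4 p k =
  p%:R * (p%:R - 1) * (p%:R - 2%:R) * (p%:R - 3%:R) /
  (k%:R * (k%:R - 1) * (k%:R - 2%:R) * (k%:R - 3%:R)).
Proof.
move=> pk; rewrite /falling4 (@formula_at p k (fun x => p%:R * (p%:R - 1) * (p%:R - 2%:R) * (p%:R - 3%:R) / (x * (x - 1) * (x - 2%:R) * (x - 3%:R)))) //.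
by have := P40 => ?; rewrite divff // !mulf_neq0 // gt_eqF //; lra.
Qed.

Lemma gainE k : (p <= k)%N -> gain p k = (p%:R - 2%:R) * (k%:R - p%:R) / (2%:R * p%:R * k%:R).
Proof.
move=> pk; rewrite /gain; case: leqP => // kp.
have -> : p = k by apply/eqP; rewrite eqn_leq pk.
by rewrite subrr mulr0 mul0r.
Qed.

Lemma clear_bound3 : clear_bound m p 3 (falling3 p).
Proof.
move=> k; have := P40 => ?; split.
- rewrite /falling3; case: leqP => // pk.
  have : (p%:R : F) <= k%:R by rewrite ler_nat ltnW.
  by move=> ?; rewrite divr_ge0 // !mulr_ge0 //; lra.
- by rewrite /falling3 => ->.
case/andP => pk _; rewrite !falling3E ?(leqW pk) // -[k.+1]addn1 natrD.
have : (p%:R : F) <= k%:R by rewrite ler_nat.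
move=> ?; rewrite le_eqVlt; apply/orP; left; apply/eqP.
by field; rewrite !gt_eqF //; lra.
Qed.

Lemma clear_bound4 : clear_bound m p 4 (falling4 p).
Proof.
move=> k; have := P40 => ?; split.
- rewrite /falling4; case: leqP => // pk.
  have : (p%:R : F) <= k%:R by rewrite ler_nat ltnW.
  by move=> ?; rewrite divr_ge0 // !mulr_ge0 //; lra.
- by rewrite /falling4 => ->.
case/andP => pk _; rewrite !falling4E ?(leqW pk) // -[k.+1]addn1 natrD.
have : (p%:R : F) <= k%:R by rewrite ler_nat.
move=> ?; rewrite le_eqVlt; apply/orP; left; apply/eqP.
by field; rewrite !gt_eqF //; lra.
Qed.

Lemma gain_bounds k : 0 <= gain p k <= 1 / 2%:R.
Proof.
have := P40 => ?; rewrite /gain; case: leqP => pk; first by apply/andP; split; lra.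
have : (p%:R : F) <= k%:R by rewrite ler_nat ltnW.
move=> ?; apply/andP; split.
  by apply: divr_ge0; [apply: mulr_ge0; lra | rewrite !mulr_ge0 //; lra].
have d0 : 0 < 2%:R * p%:R * k%:R :> F by rewrite !mulr_gt0 //; lra.
by rewrite ler_pdivrMr //; nra.
Qed.

Lemma coin_rateE k : coin_rate F k.+1 = 1 / (2%:R * (k%:R + 1)).
Proof. by rewrite /coin_rate mul1r natrM -[k.+1]addn1 natrD. Qed.

(** The increment of [gain] from [k] to [k+1] is [(p-2)/(2k(k+1))]. In the coin case this leaves the
    comparison of [1/k] with [1/(k-2)]; the in-edge case reduces to a cubic inequality valid for
    [p <= k <= 2p-1]. *)
Lemma shield_bound k : let mu i := n0 p i * gain p i in
  [/\ 0 <= mu k, (k <= p)%N -> mu k <= 0,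
  (p <= k)%N && (k.+1 < m)%N -> k.+1%:R * mu k.+1 <=
    (k.+1%:R - 2%:R) * mu k + (1 - coin_rate F k.+1) ^+ 2 * falling4 p k &
  (p <= k)%N && (k.+1 < m)%N -> k.+1%:R * mu k.+1 <=
    (k.+1%:R - 2%:R) * (mu k + coin_rate F k.+1 * falling3 p k)].
Proof.
move=> mu; have := P40 => ?; have /andP[g0 _] := gain_bounds k.
split; first by rewrite mulr_ge0 ?n0_ge0.
- by rewrite /mu /gain => ->; rewrite mulr0.
- case/andP => pk km; rewrite /mu mulrA n0_rec //; last by lia.
  rewrite -mulrA [leRHS]addrC -lerBlDr -mulrBr -mulrBr.
  have x0 : (p%:R : F) <= k%:R by rewrite ler_nat.
  (* Here sampling half of the arrivals enters, through [k.+1 < m] and [m <= 2p+1]. *)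
  have x1 : (k%:R : F) <= 2%:R * p%:R - 1.
    by rewrite lerBrDr natr1 -natrM ler_nat; lia.
  rewrite coin_rateE n0E // !gainE ?(leqW pk) // falling4E // -[k.+1]addn1 natrD.
  set x : F := k%:R in x0 x1 *; set P : F := p%:R in x0 x1 *.
  have -> : (x + 1 - 2%:R) * (P * (P - 1) / (x * (x - 1)) *
     ((P - 2%:R) * (x + 1 - P) / (2%:R * P * (x + 1)) - (P - 2%:R) * (x - P) / (2%:R * P * x)))
     = P * (P - 1) * (P - 2%:R) / (2%:R * x ^+ 2 * (x + 1)).
    by field; rewrite !gt_eqF //; lra.
  have q2 : x / (x + 1) <= (1 - 1 / (2%:R * (x + 1))) ^+ 2.
    have -> : (1 - 1 / (2%:R * (x + 1))) ^+ 2 =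
        x / (x + 1) + (1 / (2%:R * (x + 1))) ^+ 2.
      by field; rewrite gt_eqF //; lra.
    by rewrite lerDl sqr_ge0.
  have f0 : 0 <= P * (P - 1) * (P - 2%:R) * (P - 3%:R) / (x * (x - 1) * (x - 2%:R) * (x - 3%:R)).
    by rewrite divr_ge0 // !mulr_ge0 //; lra.
  apply: le_trans (ler_wpM2r f0 q2).
  have -> : x / (x + 1) * (P * (P - 1) * (P - 2%:R) * (P - 3%:R) / (x * (x - 1) * (x - 2%:R) * (x - 3%:R)))
    = P * (P - 1) * (P - 2%:R) / (2%:R * x ^+ 2 * (x + 1)) *
      (2%:R * x ^+ 2 * (P - 3%:R) / ((x - 1) * (x - 2%:R) * (x - 3%:R))).
    by field; rewrite !gt_eqF //; lra.
  rewrite ler_peMr //.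
    by rewrite divr_ge0 // ?mulr_ge0 //; lra.
  rewrite ler_pdivlMr ?mulr_gt0 //; try lra.
  rewrite mul1r; nra.
- case/andP => pk km; rewrite /mu mulrA n0_rec //; last by lia.
  rewrite -mulrA ler_wpM2l ?subr_ge0 ?ler_nat //; first by lia.
  rewrite -lerBlDl -mulrBr.
  have x0 : (p%:R : F) <= k%:R by rewrite ler_nat.
  rewrite coin_rateE n0E // !gainE ?(leqW pk) // falling3E // -[k.+1]addn1 natrD.
  set x : F := k%:R in x0 *; set P : F := p%:R in x0 *.
  have -> : P * (P - 1) / (x * (x - 1)) *
     ((P - 2%:R) * (x + 1 - P) / (2%:R * P * (x + 1)) - (P - 2%:R) * (x - P) / (2%:R * P * x))
     = (P * (P - 1) * (P - 2%:R) / (2%:R * x * (x - 1) * (x + 1))) / x.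
    by field; rewrite !gt_eqF //; lra.
  have -> : 1 / (2%:R * (x + 1)) * (P * (P - 1) * (P - 2%:R) / (x * (x - 1) * (x - 2%:R)))
     = (P * (P - 1) * (P - 2%:R) / (2%:R * x * (x - 1) * (x + 1))) / (x - 2%:R).
    by field; rewrite !gt_eqF //; lra.
  rewrite ler_wpM2l //; first by rewrite divr_ge0 // !mulr_ge0 //; lra.
  by rewrite lef_pV2 ?posrE //; lra.
Qed.

(** The first recurrence is an equality by the choice of [growth]. In the second, the halved rate of
    a dummy leaves a slack above [growth / 2], which covers the gain since [gain <= 1/2] and
    [growth >= 1]. *)
Lemma pair_bound k : let nn i := n0 p i * growth p i in
  [/\ 0 <= nn k, (k <= p)%N -> nn k <= 1,
  (p <= k)%N && (k.+1 < m)%N ->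
    k.+1%:R * nn k.+1 <= (k.+1%:R - 2%:R) * nn k + n0 p k * gain p k &
  (p <= k)%N && (k.+1 < m)%N ->
    k.+1%:R * nn k.+1 <= (k.+1%:R - 1) * (1 - coin_rate F k.+1) * nn k].
Proof.
move=> nn; have := P40 => ?; have /andP[g0 g1] := gain_bounds k.
have G1 : 1 <= growth p k.
  rewrite lerDl big_nat_cond; apply: sumr_ge0 => i /andP[/andP[pi _] _].
  have /andP[gi _] := gain_bounds i; rewrite divr_ge0 // subr_ge0 ler1n; lia.
have Grec : (p <= k)%N -> growth p k.+1 = growth p k + gain p k / (k%:R - 1).
  by move=> pk; rewrite /growth big_nat_recr //= addrA.
split.
- by rewrite mulr_ge0 ?n0_ge0 //; lra.
- by move=> kp; rewrite /nn /n0 kp mul1r /growth big_geq // addr0.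
- case/andP => pk km; rewrite /nn mulrA n0_rec //; last by lia.
  rewrite Grec // -mulrA -lerBlDl -mulrBr -mulrBr [growth p k + _]addrC addrK.
  have x0 : (p%:R : F) <= k%:R by rewrite ler_nat.
  rewrite -[k.+1]addn1 natrD mulrCA ler_wpM2l ?n0_ge0 //.
  rewrite le_eqVlt; apply/orP; left; apply/eqP.
  by field; rewrite gt_eqF //; lra.
case/andP => pk km; rewrite /nn mulrA n0_rec //; last by lia.
rewrite Grec // [leLHS]mulrAC [leRHS]mulrCA [leRHS]mulrC ler_wpM2r ?n0_ge0 //.
have x0 : (p%:R : F) <= k%:R by rewrite ler_nat.
rewrite coin_rateE -[k.+1]addn1 natrD.
set x : F := k%:R in x0 *; set G := growth p k in G1 *; set g := gain p k in g0 g1 *.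
have -> : (x + 1 - 2%:R) * (G + g / (x - 1)) = (x - 1) * G + g.
  by field; rewrite gt_eqF //; lra.
have -> : (x + 1 - 1) * (1 - 1 / (2%:R * (x + 1))) * G =
    (x - 1) * G + (1 / 2%:R + 1 / (2%:R * (x + 1))) * G.
  by field; rewrite gt_eqF //; lra.
rewrite lerD2l; have e0 : 0 <= 1 / (2%:R * (x + 1)) by rewrite divr_ge0 // mulr_ge0 //; lra.
nra.
Qed.

(** Exchange of summation, done by induction: the gain made at time [i] acts at all times [j] with
    [i < j < k], over which [1/(j(j-1))] telescopes to [1/i - 1/(k-1)]. *)
Lemma growth_sum k : (p < k)%N ->
  \sum_(p <= i < k) n0 p i * growth p i =
  p%:R * (k%:R - p%:R) / (k%:R - 1) + p%:R * (p%:R - 1) *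
    (\sum_(p <= i < k) gain p i / (i%:R - 1) * (1 / i%:R - 1 / (k%:R - 1))).
Proof.
have := P40 => ?.
have main : (p <= k)%N -> \sum_(p <= i < k) n0 p i * growth p i =
   p%:R * (p%:R - 1) * (1 / (p%:R - 1) - growth p k / (k%:R - 1) +
     \sum_(p <= i < k) gain p i / (i%:R - 1) * (1 / i%:R)).
  elim: k => [|k IH]; first by have := p40; lia.
  rewrite leq_eqVlt => /orP[/eqP <-|].
    by rewrite !big_geq // /growth big_geq // !addr0 subrr mulr0.
  rewrite ltnS => pk; rewrite !big_nat_recr //= {}IH // n0E //.
  have x0 : (p%:R : F) <= k%:R by rewrite ler_nat.
  have -> : growth p k.+1 = growth p k + gain p k / (k%:R - 1).
    by rewrite /growth big_nat_recr //= addrA.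
  rewrite -[k.+1]addn1 natrD addrK.
  move: (growth p k) (gain p k) (\sum_(_ <= _ < _) _) => G g Sg.
  by field; rewrite !gt_eqF //; lra.
move=> pk; rewrite main ?(ltnW pk) //.
have x0 : (p%:R : F) < k%:R by rewrite ltr_nat.
under [in RHS]eq_bigr do rewrite mulrBr.
rewrite sumrB -mulr_suml -[\sum_(p <= i < k) _ / _](addKr 1) -/(growth p k).
by field; rewrite !gt_eqF //; lra.
Qed.

(* The cubic minorant comes from y^-3 >= 4 - 3 y, the tangent line at 1. *)
Lemma gain_term M i : (p <= i)%N -> (i <= M)%N ->
  (p%:R - 2%:R) / (2%:R * p%:R * M%:R ^+ 5) *
    ((i%:R - p%:R) * (M%:R - i%:R) * (4%:R * M%:R - 3%:R * i%:R)) <=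
  gain p i / (i%:R - 1) * (1 / i%:R - 1 / M%:R).
Proof.
move=> pi iM; have := P40 => ?; rewrite gainE //.
have x0 : (p%:R : F) <= i%:R by rewrite ler_nat.
have x1 : (i%:R : F) <= M%:R by rewrite ler_nat.
set P : F := p%:R in x0 *; set x : F := i%:R in x0 x1 *; set y : F := M%:R in x1 *.
have -> : (P - 2%:R) * (x - P) / (2%:R * P * x) / (x - 1) * (1 / x - 1 / y) =
    (P - 2%:R) / (2%:R * P * y ^+ 5) *
    ((x - P) * (y - x) * (y ^+ 4 / (x ^+ 2 * (x - 1)))).
  by field; rewrite !gt_eqF //; lra.
apply: ler_wpM2l; first by rewrite divr_ge0 // ?mulr_ge0 ?exprn_ge0 //; lra.
apply: ler_wpM2l; first by rewrite mulr_ge0 //; lra.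
have x2 : 0 < x ^+ 2 * (x - 1) by rewrite mulr_gt0 ?exprn_gt0 //; lra.
rewrite ler_pdivlMr //.
have le1 : x ^+ 2 * (x - 1) <= x ^+ 3.
  by rewrite [leRHS]exprSr ler_wpM2l ?sqr_ge0 //; lra.
apply: le_trans (ler_wpM2l _ le1) _; first by lra.
rewrite -subr_ge0; have -> : y ^+ 4 - (4%:R * y - 3%:R * x) * x ^+ 3 =
   (y - x) ^+ 2 * (y ^+ 2 + 2%:R * x * y + 3%:R * x ^+ 2) by ring.
rewrite mulr_ge0 ?sqr_ge0 // !addr_ge0 ?sqr_ge0 ?mulr_ge0 //; lra.
Qed.

(** Put [i = p + j]: the three terms come from the power sums of [j], [j^2] and [j^3] over
    [j < K]. *)
Lemma cubic_sum (y : F) K :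
  \sum_(p <= i < p + K) ((i%:R - p%:R) * (y - i%:R) * (4%:R * y - 3%:R * i%:R)) =
  (4%:R * y - 3%:R * p%:R) * (y - p%:R) * (K%:R * (K%:R - 1) / 2%:R)
  - (4%:R * y - 3%:R * p%:R + 3%:R * (y - p%:R)) * (K%:R * (K%:R - 1) * (2%:R * K%:R - 1) / 6%:R)
  + 3%:R * (K%:R * (K%:R - 1) / 2%:R) ^+ 2.
Proof.
elim: K => [|K IH]; first by rewrite addn0 big_geq //; field.
rewrite addnS big_nat_recr ?leq_addr //= IH natrD -[K.+1]addn1 natrD.
by field.
Qed.

(** The gain is worth about [7p/768], and [1/2 + 7/768 > 40/79], where [40/79] is the coefficient of
    [p] in the target. *)
Lemma large_case : m./2 = p ->
  100%:R / 395%:R * m%:R <= \sum_(p <= i < m) n0 p i * growth p i.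
Proof.
move=> mp2; have := P40 => ?.
pose q := (m - p.+1)%N; have mE : m = (p + q.+1)%N by rewrite /q; lia.
pose M := (p + q)%N.
rewrite growth_sum; last by lia.
have P0 : 0 <= p%:R * (p%:R - 1) :> F by rewrite mulr_ge0 //; lra.
have H : (p%:R - 2%:R) / (2%:R * p%:R * M%:R ^+ 5) *
  \sum_(p <= i < m) ((i%:R - p%:R) * (M%:R - i%:R) * (4%:R * M%:R - 3%:R * i%:R)) <=
  \sum_(p <= i < m) gain p i / (i%:R - 1) * (1 / i%:R - 1 / (m%:R - 1)) :> F.
  rewrite mulr_sumr big_nat_cond [leRHS]big_nat_cond; apply: ler_sum => i /andP[/andP[pi im] _].
  have -> : m%:R - 1 = M%:R :> F by rewrite mE addnS -natr1 addrK.
  by apply: gain_term => //; rewrite /M; lia.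
apply: le_trans (lerD (lexx _) (ler_wpM2l P0 H)).
rewrite mE cubic_sum /M !natrD -[q.+1]addn1 natrD.
(* The cases of odd [m = 2p+1] and even [m = 2p]. *)
have [->|->] : q = p \/ q = p.-1 by rewrite /q; lia.
  set P : F := p%:R in P0 *.
  set lhs := leRHS.
  have -> : lhs = (P + 1) / 2%:R + 7%:R * (P - 1) ^+ 2 * (P - 2%:R) * (P + 1) / (768%:R * P ^+ 3).
    by rewrite /lhs; field; rewrite !gt_eqF //; lra.
  have : 7%:R * (P - 3%:R) / 768%:R <= 7%:R * (P - 1) ^+ 2 * (P - 2%:R) * (P + 1) / (768%:R * P ^+ 3).
    have -> : 7%:R * (P - 1) ^+ 2 * (P - 2%:R) * (P + 1) / (768%:R * P ^+ 3) =
        7%:R * (P - 3%:R) / 768%:R + 7%:R * (P ^+ 2 + 3%:R * P - 2%:R) / (768%:R * P ^+ 3).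
      by field; rewrite gt_eqF //; lra.
    by rewrite lerDl divr_ge0 ?mulr_ge0 ?exprn_ge0 //; nra.
  lra.
have -> : p.-1%:R = p%:R - 1 :> F by rewrite -subn1 natrB //; have := p40; lia.
set P : F := p%:R in P0 *.
set lhs := leRHS.
have -> : lhs = P ^+ 2 / (2%:R * P - 1) +
  (P - 1) ^+ 2 * (P - 2%:R) ^+ 2 * P * (7%:R * P - 5%:R) / (24%:R * (2%:R * P - 1) ^+ 5).
  by rewrite /lhs; field; rewrite !gt_eqF //; lra.
have h1 : P / 2%:R + 1 / 4%:R <= P ^+ 2 / (2%:R * P - 1).
  by rewrite ler_pdivlMr; [nra | lra].
have h2 : (7%:R * P - 47%:R) / 768%:R <=
  (P - 1) ^+ 2 * (P - 2%:R) ^+ 2 * P * (7%:R * P - 5%:R) / (24%:R * (2%:R * P - 1) ^+ 5).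
  have h5 : (2%:R * P - 1) ^+ 5 <= 32%:R * P ^+ 5.
    have -> : 32%:R * P ^+ 5 = (2%:R * P) ^+ 5 by ring.
    by rewrite lerXn2r ?nnegrE //; lra.
  have h6 : (P - 6%:R) * P ^+ 3 <= (P - 1) ^+ 2 * (P - 2%:R) ^+ 2.
    have -> : (P - 1) ^+ 2 * (P - 2%:R) ^+ 2 = (P - 6%:R) * P ^+ 3 + (13%:R * P ^+ 2 - 12%:R * P + 4%:R) by ring.
    by rewrite lerDl; nra.
  rewrite ler_pdivlMr; last by rewrite mulr_gt0 ?exprn_gt0 //; lra.
  apply: (@le_trans _ _ ((7%:R * P - 47%:R) / 768%:R * (24%:R * (32%:R * P ^+ 5)))).
    by rewrite ler_wpM2l ?divr_ge0 // ?ler_wpM2l //; lra.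
  apply: (@le_trans _ _ ((P - 6%:R) * P ^+ 3 * P * (7%:R * P - 5%:R))); last first.
    by rewrite ler_wpM2r; [|lra|rewrite ler_wpM2r //; lra].
  have -> : (7%:R * P - 47%:R) / 768%:R * (24%:R * (32%:R * P ^+ 5)) = (7%:R * P - 47%:R) * P * P ^+ 4 by field.
  have -> : (P - 6%:R) * P ^+ 3 * P * (7%:R * P - 5%:R) = (P - 6%:R) * (7%:R * P - 5%:R) * P ^+ 4 by ring.
  by rewrite ler_wpM2r ?exprn_ge0 //; nra.
lra.
Qed.

End Large.
End Numerics.

(** * From random seeds to a behavioural algorithm *)

Section Algorithm.
Variables n m : nat.
Local Notation coins := (coins n).
Local Notation labelled := (obs n * nat)%type.
Implicit Types (h : seq (obs n * bool)) (os : seq (obs n)) (o : obs n).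

Definition lends (x : labelled) : 'I_n * 'I_n := x.1.1.
Definition lgt : rel labelled := fun x y =>
  (y.1.2 < x.1.2) || (x.1.2 == y.1.2) && (y.2 < x.2)%N.

(* The private randomness: a tie-breaking label and a vector of coins for every
   arrival time. *)
Definition seed := ({perm 'I_m} * {ffun 'I_m -> coins})%type.
Implicit Types omega : seed.

Definition label omega k : nat := if insub k is Some i then val (omega.1 i) else 0.
Definition coin omega k : coins :=
  if insub k is Some i then omega.2 i else [ffun=> false].

Definition ostep omega (st : seq labelled * {set 'I_n}) o :=
  mstep lends lgt m./2 st (o, label omega (size st.1)) (coin omega (size st.1)).
Definition ostate omega os := foldl (ostep omega) ([::], set0) os.
Definition decide omega os o : bool :=
  accepts lends lgt m./2 (ostate omega os) (o, label omega (size (ostate omega os).1)).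

(** For a fixed seed the state depends on the observations alone, so the recorded decisions are only
    compared with those the seed would have made. *)
Definition replay omega h := foldl
  (fun st q => (rcons st.1 q.1, st.2 && (q.2 == decide omega st.1 q.1))) ([::], true) h.
Definition consistent omega h : bool := (replay omega h).2.

Lemma replay1 omega h : (replay omega h).1 = [seq q.1 | q <- h].
Proof.
elim/last_ind: h => // h q IH.
by rewrite /replay -cats1 foldl_cat /= -/(replay omega h) IH map_cat /= cats1.
Qed.

Lemma consistent_rcons omega h o b : consistent omega (rcons h (o, b)) =
  consistent omega h && (b == decide omega [seq q.1 | q <- h] o).
Proof. by rewrite /consistent /replay -cats1 foldl_cat /= -/(replay omega h) replay1. Qed.

Section Mass.
Variable F : realFieldType.

Definition seed_weight omega : F :=
  m`!%:R^-1 * \prod_(i < m) coin_weight F i.+1 (omega.2 i).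

Lemma seed_weight_ge0 omega : 0 <= seed_weight omega.
Proof.
rewrite mulr_ge0 ?invr_ge0 // prodr_ge0 // => i _.
exact: coin_weight_ge0.
Qed.

Lemma sum_seed_weight : \sum_(omega : seed) seed_weight omega = 1.
Proof.
rewrite -mulr_sumr -(pair_bigA _ (fun (pi : {perm 'I_m}) (z : {ffun 'I_m -> coins}) => \prod_(i < m) coin_weight F i.+1 (z i))) /=.
have e : \sum_(pi : {perm 'I_m}) \sum_(z : {ffun 'I_m -> coins})
    \prod_(i < m) coin_weight F i.+1 (z i) = m`!%:R.
  have := Ex_orders (fun _ : seq ('I_m * coins) => 1 : F).
  rewrite Ex_cst ?cardsT ?card_ord // mulr1 => <-.
  by apply: eq_bigr => pi _; apply: eq_bigr => z _; rewrite mulr1.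
by rewrite e mulVf // pnatr_eq0 -lt0n fact_gt0.
Qed.

Definition mass h : F := \sum_omega seed_weight omega * (consistent omega h)%:R.

Lemma mass_ge0 h : 0 <= mass h.
Proof. by apply: sumr_ge0 => omega _; rewrite mulr_ge0 ?seed_weight_ge0. Qed.

Lemma mass_split h o : mass (rcons h (o, true)) + mass (rcons h (o, false)) = mass h.
Proof.
rewrite -big_split; apply: eq_bigr => omega _; rewrite /= !consistent_rcons.
by case: (consistent _ _); case: (decide _ _ _); rewrite /= ?mulr0 ?mulr1 ?addr0 ?add0r.
Qed.

Lemma mass0 : mass [::] = 1.
Proof. by rewrite -sum_seed_weight; apply: eq_bigr => omega _; rewrite mulr1. Qed.

(* Bayes' rule: the behavioural form of the mixture over seeds. *)
Definition posterior h o : F := mass (rcons h (o, true)) / mass h.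

Lemma posterior_bounds h o : 0 <= posterior h o <= 1.
Proof.
rewrite /posterior; have := mass_split h o; have := mass_ge0 (rcons h (o, false)).
have := mass_ge0 (rcons h (o, true)); have := mass_ge0 h.
(* A history of mass 0 gets posterior 0, the inverse of 0 being 0. *)
rewrite le_eqVlt => /orP[/eqP <- _ _ _|h0 t0 f0 e]; first by rewrite invr0 mulr0 lexx ler01.
by rewrite divr_ge0 ?(ltW h0) //= ler_pdivrMr // mul1r -e lerDl.
Qed.

Lemma mass_posterior h o b : mass h != 0 ->
  mass h * (if b then posterior h o else 1 - posterior h o) = mass (rcons h (o, b)).
Proof.
move=> h0; case: b; rewrite ?mulrBr mulrCA mulfV // mulr1 //.
by rewrite -(mass_split h o) mulr1 addrAC subrr add0r.
Qed.

End Mass.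
End Algorithm.

Definition posterior_alg : online_alg := fun n m h ob => posterior m R h ob.

(** * The behavioural algorithm simulates the mixture over seeds *)

Section Trace.
Variables n m : nat.
Local Notation coins := (coins n).
Local Notation labelled := (obs n * nat)%type.
Local Notation lends := (@lends n).
Local Notation lgt := (@lgt n).
Local Notation seed := (seed n m).
Implicit Types omega : seed.
Variables (ends : 'I_m -> 'I_n * 'I_n) (w : 'I_m -> R).
Hypothesis loop : loopless ends.
Variable sigma : {perm 'I_m}.
Implicit Types i j : 'I_m.

Definition lab (ell : {perm 'I_m}) (e : 'I_m) : labelled :=
  (obs_of ends w e, val (ell e)).

Lemma lends_lab ell e : lends (lab ell e) = ends e.
Proof. by rewrite [RHS]surjective_pairing. Qed.

Lemma lab_inj ell : injective (lab ell).
Proof. by move=> e f [_ _ _ /val_inj/perm_inj]. Qed.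

Lemma lab_order ell S : strict_order_on lgt (edges (lab ell) S).
Proof.
split.
- by move=> x; rewrite /lgt ltxx ltnn andbF.
- move=> y x z; rewrite /lgt => /orP[xy|/andP[/eqP xy lxy]] /orP[yz|/andP[/eqP yz lyz]].
  + by rewrite (lt_trans yz xy).
  + by rewrite -yz xy.
  + by rewrite xy yz.
  + by rewrite xy yz eqxx (ltn_trans lyz lxy) orbT.
move=> x y /edgesP[e _ ->] /edgesP[f _ ->] ef; rewrite /lgt /=.
case: ltgtP => //= _; rewrite -neq_ltn.
by apply: contraNneq ef => /val_inj/perm_inj ->.
Qed.

Definition seen i := obs_of ends w (sigma i).
Definition before i := take i (enum 'I_m).
Definition decision omega i := decide omega [seq seen j | j <- before i] (seen i).

Lemma take_enum i : take i.+1 (enum 'I_m) = rcons (before i) i.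
Proof. by rewrite (take_nth i) ?size_enum_ord // nth_ord_enum. Qed.

Section Seed.
Variable omega : seed.
(** Seeds attach labels to arrival times, the analysis attaches them to edges; edge [e] arrives at
    time [sigma^-1 e]. *)
Let L := lab (sigma^-1 * omega.1)%g.
Let events s := rev [seq (sigma j, omega.2 j) | j <- s].

Lemma ostate_mst k : (k <= m)%N ->
  ostate omega [seq seen j | j <- take k (enum 'I_m)] =
  mst lends lgt L m./2 (events (take k (enum 'I_m))).
Proof.
elim: k => [|k IH] km; first by rewrite take0.
pose i := Ordinal km; rewrite -[k.+1]/(i.+1) take_enum.
have {}IH := IH (ltnW km).
rewrite /events !map_rcons rev_rcons /ostate -cats1 foldl_cat /= -/(ostate _ _) IH.
rewrite /ostep size_mst size_rev size_map size_take size_enum_ord km.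
rewrite /label /coin -[k]/(val i) valK /L /lab /= permM permK.
by [].
Qed.

Lemma decisionE i :
  decision omega i = accepts lends lgt m./2 (mst lends lgt L m./2 (events (before i))) (L (sigma i)).
Proof.
rewrite /decision /decide /before.
have e := ostate_mst (ltnW (ltn_ord i)).
rewrite e.
rewrite size_mst.
rewrite size_rev size_map size_take size_enum_ord ltn_ord.
rewrite /label valK.
by rewrite /L /lab permM permK.
Qed.

Definition chosen (d : pred 'I_m) (s : seq 'I_m) : {set 'I_m} :=
  [set e | has (fun j => (sigma j == e) && d j) s].

Lemma chosen_rcons d s i :
  chosen d (rcons s i) = if d i then sigma i |: chosen d s else chosen d s.
Proof.
apply/setP => e; rewrite inE has_rcons.
by case: (d i); rewrite !inE ?andbT ?andbF // eq_sym.
Qed.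

Lemma eq_chosen d d' s : {in s, d =1 d'} -> chosen d s = chosen d' s.
Proof. by move=> dd; apply/setP => e; rewrite !inE; apply: eq_in_has => j /dd ->. Qed.

Lemma accepted_events k : (k <= m)%N ->
  accepted lends lgt L m./2 (events (take k (enum 'I_m))) =
  chosen (decision omega) (take k (enum 'I_m)).
Proof.
elim: k => [|k IH] km; first by rewrite take0; apply/setP => e; rewrite !inE.
pose i := Ordinal km; rewrite -[k.+1]/(i.+1) take_enum chosen_rcons -IH ?(ltnW km) //.
by rewrite /events map_rcons rev_rcons /= decisionE.
Qed.

(** By [accepted_safe] each seed keeps its accepted set acyclic, so the feasibility test in [step]
    never overrules it. *)
Lemma decision_feasible i : decision omega i ->
  acyclic ends (sigma i |: chosen (decision omega) (before i)).
Proof.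
move=> di; have [h [acy _ _ _]] := accepted_safe loop lgt m./2 (lends_lab _)
   (events (take i.+1 (enum 'I_m))) (L := L).
by move: acy; rewrite accepted_events // take_enum chosen_rcons di.
Qed.

End Seed.

Let chronicle (d : pred 'I_m) s := [seq (seen j, d j) | j <- s].

Lemma consistentE omega (d : pred 'I_m) k : (k <= m)%N ->
  consistent omega (chronicle d (take k (enum 'I_m))) =
  all (fun j => d j == decision omega j) (take k (enum 'I_m)).
Proof.
elim: k => [|k IH] km; first by rewrite take0.
pose i := Ordinal km; rewrite -[k.+1]/(i.+1) take_enum /chronicle map_rcons all_rcons.
rewrite consistent_rcons -/(chronicle d _) IH ?(ltnW km) // andbC; congr (_ && _).
by rewrite /decision -map_comp.
Qed.

Lemma mass_rcons_ge0 (h : seq (obs n * bool)) (ob : obs n) b : 0 <= mass m R (rcons h (ob, b)) <= mass m R h.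
Proof.
rewrite mass_ge0 -(mass_split m R h ob).
by case: b; rewrite ?lerDl ?lerDr mass_ge0.
Qed.

(** No seed agrees with such a history, so the posterior already rejects what [step] forbids. *)
Lemma mass_infeasible d i :
  ~ acyclic ends (sigma i |: chosen d (before i)) ->
  mass m R (rcons (chronicle d (before i)) (seen i, true)) = 0.
Proof.
move=> nacy; apply: big1 => omega _.
case: (boolP (consistent _ _)) => [|_]; last by rewrite mulr0.
rewrite consistent_rcons consistentE ?(ltnW (ltn_ord i)) // => /andP[/allP dd /eqP di].
case: nacy; rewrite (@eq_chosen _ (decision omega)) => [|j jb]; last exact/eqP/dd.
by apply: decision_feasible; rewrite -map_comp in di; exact: esym di.
Qed.

(** History and accepted set are claimed only on branches of nonzero probability: where [d] accepts
    an infeasible edge, [step] records a rejection, but then [pr] and the mass are both 0. *)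
Lemma run_prefix (d : {ffun 'I_m -> bool}) k : (k <= m)%N ->
  let: (h, A, pr) := foldl (step posterior_alg ends w sigma d) ([::], set0, 1) (take k (enum 'I_m)) in
  pr = mass m R (chronicle d (take k (enum 'I_m))) /\
  (pr != 0 -> h = chronicle d (take k (enum 'I_m)) /\ A = chosen d (take k (enum 'I_m))).
Proof.
elim: k => [|k IH] km.
  by rewrite take0; split=> [|_]; [rewrite mass0|split=> //; apply/setP => e; rewrite !inE].
pose i := Ordinal km; rewrite -[k.+1]/(i.+1) take_enum foldl_rcons.
move: (IH (ltnW km)); rewrite -/(before i).
case: (foldl _ _ _) => [[h A] pr] [-> hA].
rewrite /step /chronicle map_rcons chosen_rcons -/(chronicle d (before i)) -/(seen i).
set M := mass m R (chronicle d (before i)) in hA *.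
have /andP[N0 N1] := mass_rcons_ge0 (chronicle d (before i)) (seen i) (d i).
have [M0|M0] := eqVneq M 0.
  rewrite M0 mul0r; split; last by rewrite eqxx.
  by apply/eqP; rewrite eq_le N0 -M0 N1.
have [-> ->] := hA M0.
case: (pselect (acyclic ends (sigma i |: chosen d (before i)))) => [fe|nfe].
  rewrite asboolT // andbT; split; last by [].
  exact: mass_posterior.
rewrite asboolF // andbF.
case di : (d i).
  by rewrite mulr0 mass_infeasible //; split=> //; rewrite eqxx.
rewrite subr0 mulr1; split; last by [].
by rewrite /M -(mass_split m R _ (seen i)) mass_infeasible // add0r.
Qed.

Lemma expected_run (d : {ffun 'I_m -> bool}) :
  (let: (_, A, pr) := run posterior_alg ends w sigma d in pr * wsum w A) =
  \sum_(omega : seed) seed_weight R omega *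
    ((d == finfun (decision omega))%:R * wsum w (chosen d (enum 'I_m))).
Proof.
have te : take m (enum 'I_m) = enum 'I_m by rewrite take_oversize // size_enum_ord.
have := run_prefix d (leqnn m); rewrite te /run.
case: (foldl _ _ _) => [[h A] pr] [-> hA].
transitivity (mass m R (chronicle d (enum 'I_m)) * wsum w (chosen d (enum 'I_m))).
  have [->|/hA[_ ->] //] := eqVneq (mass m R (chronicle d (enum 'I_m))) 0.
  by rewrite !mul0r.
rewrite /mass mulr_suml; apply: eq_bigr => omega _; rewrite -mulrA; congr (_ * (_%:R * _)).
congr nat_of_bool.
have -> : chronicle d (enum 'I_m) = chronicle d (take m (enum 'I_m)) by rewrite te.
rewrite consistentE // te; apply/allP/eqP => [dd|-> j _]; last by rewrite ffunE.
by apply/ffunP => j; rewrite ffunE; apply/eqP/dd; rewrite mem_enum.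
Qed.

End Trace.

(** * The competitive ratio *)

Section Competitive.
Variables (n m : nat) (ends : 'I_m -> 'I_n * 'I_n) (w : 'I_m -> R).
Hypotheses (loop : loopless ends) (w0 : forall e, 0 <= w e).

Definition value_of ell (l : seq ('I_m * coins n)) : R :=
  \sum_(e in accepted (@lends n) (@lgt n) (lab ends w ell) m./2 l) w e.

(** For a fixed order the substitution [pi = sigma * ell] turns random labels of times into random
    labels of edges, independent of the order. For each [ell] the sum over orders and coins is then
    given by [Ex_orders]. *)
Lemma expected_ALG_Ex : expected_ALG posterior_alg ends w =
  m`!%:R^-1 * \sum_(ell : {perm 'I_m}) Ex m setT (value_of ell).
Proof.
rewrite /expected_ALG; congr (_ * _).
have te : take m (enum 'I_m) = enum 'I_m by rewrite take_oversize // size_enum_ord.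
transitivity (\sum_(sigma : {perm 'I_m}) \sum_(ell : {perm 'I_m})
   \sum_(z : {ffun 'I_m -> coins n}) (m`!%:R^-1 *
     ((\prod_(i < m) coin_weight R i.+1 (z i)) * value_of ell (rev (sequence sigma z))))).
  apply: eq_bigr => sigma _.
  under eq_bigr do rewrite (expected_run _ loop).
  rewrite exchange_big.
  transitivity (\sum_(omega : seed n m) seed_weight R omega *
      value_of (sigma^-1 * omega.1)%g (rev (sequence sigma omega.2))).
    apply: eq_bigr => omega _; rewrite -mulr_sumr; congr (_ * _).
    rewrite (bigD1 (finfun (decision ends w sigma omega))) //= eqxx mul1r big1 ?addr0; last first.
      by move=> d /negPf ->; rewrite mul0r.
    rewrite /value_of /sequence -{2}te accepted_events // te.
    apply: eq_bigl => e; rewrite !inE.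
    by apply: eq_has => j; rewrite ffunE.
  rewrite -(pair_bigA _ (fun (pi : {perm 'I_m}) (z : {ffun 'I_m -> coins n}) =>
     seed_weight R (pi, z) * value_of (sigma^-1 * pi)%g (rev (sequence sigma z)))).
  rewrite (reindex_inj (mulgI sigma)); apply: eq_bigr => ell _; apply: eq_bigr => z _.
  by rewrite mulKg /seed_weight -mulrA.
rewrite exchange_big; apply: eq_bigr => ell _.
under eq_bigr do rewrite -mulr_sumr.
rewrite -mulr_sumr Ex_orders mulKf // pnatr_eq0 -lt0n fact_gt0 //.
Qed.

Lemma OPT_tree ell : OPT ends w <=
  \sum_(e in setT | intree (@lends n) (@lgt n) (lab ends w ell) setT e) w e.
Proof.
have T0 : 0 <= \sum_(e in setT | intree (@lends n) (@lgt n) (lab ends w ell) setT e) w e.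
  by apply: sumr_ge0.
apply: bigmax_le => // F /asboolP acF.
(* [forest_weight] wants nonnegative weights on all labelled observations, hence the truncation at
   0, harmless on actual edges. *)
pose wt (x : obs n * nat) : R := Num.max 0 x.1.2.
have wtE e : wt (lab ends w ell e) = w e by apply/max_idPr; apply: w0.
have wt0 x : 0 <= wt x by rewrite /wt le_max lexx.
have wt_gt x y : lgt x y -> wt y <= wt x.
  move=> /orP[/ltW|/andP[/eqP e _]]; last by rewrite /wt e.
  by move=> xy; rewrite /wt ge_max !le_max lexx xy orbT.
have uE S : uniq (edges (lab ends w ell) S) by apply: uniq_edges; apply: lab_inj.
have sub : {subset edges (lab ends w ell) F <= edges (lab ends w ell) setT}.
  by move=> x /edgesP[e _ ->]; rewrite mem_edges ?inE //; apply: lab_inj.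
have := forest_weight (lab_order ends w ell setT) wt0 wt_gt (uE setT) (uE F) sub
  (acyclic_forest loop (lends_lab ends w ell) (lab_inj (ell := ell)) acF).
have -> : \sum_(x <- edges (lab ends w ell) F) wt x = wsum w F.
  by rewrite big_map big_enum; apply: eq_bigr => e _; apply: wtE.
rewrite /tree big_filter big_map big_enum_cond => /le_trans; apply.
rewrite le_eqVlt; apply/orP; left; apply/eqP.
apply: eq_big => [e|e _]; last by apply: wtE.
by rewrite /intree mem_tree.
Qed.

Lemma Ex_value ell :
  100%:R / 395%:R * \sum_(e in setT | intree (@lends n) (@lgt n) (lab ends w ell) setT e) w e <=
  Ex m setT (value_of ell).
Proof.
set W := \sum_(e in setT | _) w e.
have W0 : 0 <= W by apply: sumr_ge0.
have cT : #|[set: 'I_m]| = m by rewrite cardsT card_ord.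
have [m0|m0] := posnP m.
  have -> : W = 0 by apply: big1 => e _; have := ltn_ord e; rewrite {2}m0.
  rewrite mulr0 -(Ex_cst n 0 cT); apply: Ex_le => // l _.
  by apply: sumr_ge0.
have scale (nn : nat -> R) : 100%:R / 395%:R * m%:R <= \sum_(m./2 <= i < m) nn i ->
    100%:R / 395%:R * W <= m%:R^-1 * (\sum_(m./2 <= i < m) nn i) * W.
  by move=> H; rewrite ler_wpM2r // ler_pdivlMl ?ltr0n // mulrC.
(* Small instances need no gain: [nu3], [nu4] and [mu] are set to 0 and [nn] to [n0]. *)
have [p39|p40] := leqP m./2 39.
  apply: le_trans (scale _ (small_case R m0 p39)) _.
  have zero j : clear_bound m m./2 j (fun=> 0 : R).
    by move=> k; split; rewrite ?mulr0 // => _; rewrite ler01.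
  apply: (expected_value loop (lends_lab ends w ell) (lab_inj (ell := ell))
    (lab_order ends w ell) (zero 3) (zero 4) (mu := fun=> 0) _ _ w0 cT) => k.
    by rewrite !mulr0 addr0 mulr0.
  exact: small_pair_bound.
have mp : (m <= 2 * m./2 + 1)%N by lia.
apply: le_trans (scale _ (large_case R p40 mp (erefl _))) _.
apply: (expected_value loop (lends_lab ends w ell) (lab_inj (ell := ell))
    (lab_order ends w ell) (clear_bound3 R m p40) (clear_bound4 R m p40) _ _ w0 cT) => k.
  exact: shield_bound.
exact: pair_bound.
Qed.

Lemma posterior_competitive :
  OPT ends w <= 395%:R / 100%:R * expected_ALG posterior_alg ends w.
Proof.
rewrite expected_ALG_Ex.
rewrite mulrCA ler_pdivlMl ?ltr0n ?fact_gt0 // mulr_sumr.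
have -> : m`!%:R * OPT ends w = \sum_(ell : {perm 'I_m}) OPT ends w.
  by rewrite sumr_const card_Sn mulr_natl.
apply: ler_sum => ell _; apply: le_trans (OPT_tree ell) _.
by rewrite -ler_pdivrMl ?divr_gt0 ?ltr0n // invf_div; apply: Ex_value.
Qed.

End Competitive.

Theorem theorem1 :
  exists alg : online_alg,
    valid_alg alg /\
    forall (n m : nat) (ends : 'I_m -> 'I_n * 'I_n) (w : 'I_m -> R),
      loopless ends ->
      (forall e, 0 <= w e) ->
      (395%:R / 100%:R : R) * expected_ALG alg ends w >= OPT ends w.
Proof.
exists posterior_alg; split=> [n m h ob|n m ends w loop w0].
  exact: posterior_bounds.
exact: posterior_competitive.
Qed.
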